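(* Suppose $\mathcal{R}$ is a Urysohn monoid, and assume that $\mathrm{SO}(\mathcal{U}_{\mathcal{R}})<\omega$ (i.e. $\mathrm{arch}(\mathcal{R})<\omega$). Then $\mathrm{Th}(\mathcal{U}_{\mathcal{R}})$ has weak elimination of imaginaries if and only if $\mathcal{R}$ is archimedean.
   Context: A distance monoid is a structure $\mathcal{R}=(R,\oplus,\leq,0)$ such that $(R,\oplus,0)$ is a commutative monoid and $\leq$ is a total, translation-invariant order on $R$ with least element $0$. An $\mathcal{R}$-metric space is a set $A$ with a symmetric function $d:A\times A\to R$ such that $d(x,y)=0$ iff $x=y$, and $d(x,z)\leq d(x,y)\oplus d(y,z)$ for all $x,y,z\in A$. For countable $\mathcal{R}$, the $\mathcal{R}$-Urysohn space $\mathcal{U}_{\mathcal{R}}$ is the unique (up to isometry) countable $\mathcal{R}$-metric space that is ultrahomogeneous and contains an isometric copy of every finite $\mathcal{R}$-metric space. It is viewed as a structure in the relational language $\mathcal{L}_R=\{d(x,y)\leq r:r\in R\}$ of binary relations, and $\mathrm{Th}(\mathcal{U}_{\mathcal{R}})$ is its complete $\mathcal{L}_R$-theory. A Urysohn monoid is a countable distance monoid $\mathcal{R}$ such that $\mathrm{Th}(\mathcal{U}_{\mathcal{R}})$ has quantifier elimination in $\mathcal{L}_R$. A distance monoid $\mathcal{R}$ is archimedean if for all $r,s\in R$ with $r,s>0$ there is some integer $n>0$ such that $s\leq nr$, where $nr$ is the $n$-fold sum $r\oplus\cdots\oplus r$. The archimedean complexity $\mathrm{arch}(\mathcal{R})$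 is the minimum $n<\omega$ such that $r_0\oplus r_1\oplus\ldots\oplus r_n=r_1\oplus\ldots\oplus r_n$ for all $r_0\leq r_1\leq\ldots\leq r_n$ in $R$ (an empty sum being $0$); if no such $n$ exists, $\mathrm{arch}(\mathcal{R})=\omega$. Strong order rank: for a complete theory $T$ with monster model $\mathbb{M}$, an indiscernible sequence $(\bar a^l)_{l<\omega}$ of (possibly infinite) tuples is $n$-cyclic if $p(\bar x^1,\bar x^2)\cup\ldots\cup p(\bar x^{n-1},\bar x^n)\cup p(\bar x^n,\bar x^1)$ is consistent, where $p(\bar x,\bar y)=\mathrm{tp}(\bar a^0,\bar a^1)$. $\mathrm{SO}(T)\leq n$ means that every indiscernible sequence in $\mathbb{M}$ is $(n+1)$-cyclic. $\mathrm{SO}(\mathcal{U}_{\mathcal{R}})=\mathrm{SO}(\mathrm{Th}(\mathcal{U}_{\mathcal{R}}))$, and $\mathrm{SO}(\mathcal{U}_{\mathcal{R}})<\omega$ means $\mathrm{SO}(\mathcal{U}_{\mathcal{R}})\leq n$ for some $n<\omega$; for Urysohn monoids this is equivalent to $\mathrm{arch}(\mathcal{R})<\omega$. A weak canonical parameter for an imaginary $e\in\mathbb{M}^{\mathrm{eq}}$ is a finite tuple $\bar c$ of elements of $\mathbb{M}$ such that $\bar c\in\mathrm{acl}^{\mathrm{eq}}(e)$ and $e\in\mathrm{dcl}^{\mathrm{eq}}(\bar c)$. $T$ has weak elimination of imaginaries if every imaginary has a weak canonical parameter. *)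

(* Defs.v *)
From mathcomp Require Import all_boot all_algebra.
From mathcomp Require Import all_classical.

Set Implicit Arguments.
Unset Strict Implicit.
Unset Printing Implicit Defensive.

Local Open Scope classical_set_scope.
Local Open Scope card_scope.

(** * Distance monoids and metric spaces over them *)

Structure distMonoid := DistMonoid {
  dm_sort :> nmodType;
  dle : rel dm_sort;
  dle_refl : reflexive dle;
  dle_anti : antisymmetric dle;
  dle_trans : transitive dle;
  dle_total : total dle;
  dle0r : forall x, dle 0%R x;
  dle_add2r : forall x y z, dle x y -> dle (x + z)%R (y + z)%R
}.

Definition dlt (R : distMonoid) (x y : R) : bool := (x != y) && dle x y.

Definition archimedean (R : distMonoid) : Prop :=
  forall r s : R, dlt 0%R r -> dlt 0%R s ->
    exists n : nat, (0 < n)%N /\ dle s (r *+ n)%R.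

Structure rmetric (R : distMonoid) := RMetric {
  rm_sort :> Type;
  dist : rm_sort -> rm_sort -> R;
  dist_sym : forall x y, dist x y = dist y x;
  dist_eq0 : forall x y, dist x y = 0%R <-> x = y;
  dist_triangle : forall x y z, dle (dist x z) (dist x y + dist y z)%R
}.

Section Urysohn.
Context (R : distMonoid).

Definition isometric_on (X Y : rmetric R) (A : set X) (f : X -> Y) : Prop :=
  forall x y, A x -> A y -> dist (f x) (f y) = dist x y.

(* Isometries are injective because [dist x y = 0] iff [x = y]. *)
Definition ultrahomogeneous (U : rmetric R) : Prop :=
  forall (A : set U) (f : U -> U), finite_set A -> isometric_on A f ->
  exists g : U -> U,
    [/\ isometric_on setT g, (forall y, exists x, g x = y)
      & forall x, A x -> g x = f x].

Definition urysohn_space (U : rmetric R) : Prop :=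
  [/\ countable [set: U],
      ultrahomogeneous U
    & forall X : rmetric R, finite_set [set: X] ->
        exists f : X -> U, isometric_on setT f].

End Urysohn.

(** * First-order logic over relational signatures *)

Structure signature := Signature {
  symb : Type;
  arity : symb -> nat
}.

Structure structure (L : signature) := Structure {
  univ :> Type;
  interp : forall s : symb L, ('I_(arity s) -> univ) -> Prop
}.

(* Formulas whose free variables are indexed by the type [V]; the bound
   variable of [FAll] is [None]. *)
Inductive fo_form (L : signature) (V : Type) : Type :=
| FBot
| FEq (x y : V)
| FRel (s : symb L) (v : 'I_(arity s) -> V)
| FImp (phi psi : fo_form L V)
| FAll (phi : fo_form L (option V)).

Section Logic.
Context (L : signature).
Implicit Types M N : structure L.

Fixpoint sat M (V : Type) (phi : fo_form L V) : (V -> M) -> Prop :=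
  match phi with
  | FBot => fun _ => False
  | FEq x y => fun a => a x = a y
  | FRel s v => fun a => interp (fun i => a (v i))
  | FImp phi psi => fun a => sat phi a -> sat psi a
  | FAll phi => fun a => forall b : M, sat phi (oapp a b)
  end.

Fixpoint qfree (V : Type) (phi : fo_form L V) : bool :=
  match phi with
  | FBot | FEq _ _ | FRel _ _ => true
  | FImp phi psi => qfree phi && qfree psi
  | FAll _ => false
  end.

Fixpoint rename (V W : Type) (f : V -> W) (phi : fo_form L V) : fo_form L W :=
  match phi with
  | FBot => @FBot L W
  | FEq x y => FEq L (f x) (f y)
  | FRel s v => FRel (fun i => f (v i))
  | FImp phi psi => FImp (rename f phi) (rename f psi)
  | FAll phi => FAll (rename (omap f) phi)
  end.

Definition theory : Type := set (fo_form L void).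

Definition Th M : theory := [set phi | sat phi (of_void M)].

Definition models (T : theory) M : Prop := T `<=` Th M.

Definition quantifier_elimination (T : theory) : Prop :=
  forall n (phi : fo_form L 'I_n), exists psi : fo_form L 'I_n,
    qfree psi /\
    forall M, models T M -> forall a : 'I_n -> M, sat phi a <-> sat psi a.

(* The complete type over the empty set of a tuple indexed by [V]. *)
Definition tp M (V : Type) (a : V -> M) : set (fo_form L V) :=
  [set phi | sat phi a].

(* Consistency with the complete theory of [M]. *)
Definition consistent M (V : Type) (S : set (fo_form L V)) : Prop :=
  forall F : set (fo_form L V), finite_set F -> F `<=` S ->
    exists a : V -> M, forall phi, F phi -> sat phi a.

(** * Monster models *)

(* [|A| < |B|] *)
Definition card_lt (A B : Type) : Prop :=
  [set: A] #<= [set: B] /\ ~ ([set: B] #<= [set: A]).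

Definition automorphism M (g : M -> M) : Prop :=
  [/\ injective g, (forall y, exists x, g x = y)
    & forall (s : symb L) (v : 'I_(arity s) -> M),
        interp (fun i => g (v i)) <-> interp v].

(* In [saturated], [None] is the variable of the type and the remaining
   variables name the parameters [c]. *)
Definition saturated (K : Type) M : Prop :=
  forall (A : Type) (c : A -> M), card_lt A K ->
  forall S : set (fo_form L (option A)),
    (forall F, finite_set F -> F `<=` S ->
       exists b : M, forall phi, F phi -> sat phi (oapp c b)) ->
    exists b : M, forall phi, S phi -> sat phi (oapp c b).

Definition strongly_homogeneous (K : Type) M : Prop :=
  forall (A : Type) (a b : A -> M), card_lt A K -> tp a = tp b ->
    exists2 g : M -> M, automorphism g & forall i, g (a i) = b i.

(* [K] plays the role of the cardinal below which sets are small; it exceeds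
   the number of formulas. *)
Definition monster (T : theory) (K : Type) M : Prop :=
  [/\ card_lt nat K, card_lt (symb L) K, models T M,
      saturated K M & strongly_homogeneous K M].

(** * Strong order rank *)

Definition indiscernible M (I : Type) (a : nat -> I -> M) : Prop :=
  forall k (u v : 'I_k -> nat),
    {homo u : i j / (i < j)%N} -> {homo v : i j / (i < j)%N} ->
    tp (fun x : 'I_k * I => a (u x.1) x.2) =
    tp (fun x : 'I_k * I => a (v x.1) x.2).

(* The variables of the type [p] of the first two terms are indexed by
   [bool * I], with [false] for the first tuple and [true] for the second one;
   [ordS] is the cyclic successor. *)
Definition cyclic_seq M (I : Type) (n : nat) (a : nat -> I -> M) : Prop :=
  let p := tp (fun x : bool * I => a (nat_of_bool x.1) x.2) in
  @consistent M ('I_n * I)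
    (\bigcup_(j in [set: 'I_n])
       rename (fun x : bool * I => (if x.1 then ordS j else j, x.2)) @` p).

Definition SO_le (K : Type) M (n : nat) : Prop :=
  forall (I : Type) (a : nat -> I -> M), card_lt I K ->
    indiscernible a -> cyclic_seq n.+1 a.

Definition SO_finite (K : Type) M : Prop := exists n, SO_le K M n.

(** * Algebraic and definable closure *)

(* [x] is in the algebraic (resp. definable) closure of [B]; the parameters of
   the witnessing formula are the values of [b]. *)
Definition acl N (B : set N) (x : N) : Prop :=
  exists n (b : 'I_n -> N) (phi : fo_form L (option 'I_n)),
    [/\ forall i, B (b i), sat phi (oapp b x)
      & finite_set [set y | sat phi (oapp b y)]].

Definition dcl N (B : set N) (x : N) : Prop :=
  exists n (b : 'I_n -> N) (phi : fo_form L (option 'I_n)),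
    (forall i, B (b i)) /\ [set y | sat phi (oapp b y)] = [set x].

(** * Imaginaries *)

Definition equivalence (T : Type) (E : T -> T -> Prop) : Prop :=
  [/\ forall x, E x x, forall x y, E x y -> E y x
    & forall x y z, E x y -> E y z -> E x z].

Definition rel_of_form M n (phi : fo_form L (bool * 'I_n)) (a b : 'I_n -> M) :=
  sat phi (fun x => if x.1 then b x.2 else a x.2).

(* The sorts of [M^eq] other than the home sort: formulas without parameters
   defining an equivalence relation on [M^n], for some [n]. *)
Structure eqsort M := EqSort {
  eqsize : nat;
  eqform : fo_form L (bool * 'I_eqsize);
  eqformP : equivalence (@rel_of_form M eqsize eqform)
}.

Definition eqrel M (S : eqsort M) : ('I_(eqsize S) -> M) -> _ -> Prop :=
  rel_of_form (eqform S).

Structure imaginary M := Imaginary {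
  imsort : eqsort M;
  imclass : set ('I_(eqsize imsort) -> M);
  imclassP : exists a, imclass = [set b | eqrel a b]
}.

Definition im_proj M (S : eqsort M) (a : 'I_(eqsize S) -> M) : imaginary M :=
  @Imaginary M S [set b | eqrel a b] (ex_intro _ a erefl).

(* One-sorted relational presentation of [M^eq], with a predicate for each
   sort and the graph of the projection [M^n -> M^n/E] for each sort [E]. *)
Inductive eqsymb M : Type :=
| EqBase (s : symb L)
| EqHome
| EqIn (E : eqsort M)
| EqProj (E : eqsort M).

Definition eqsig M : signature :=
  @Signature (eqsymb M) (fun s =>
    match s with
    | EqBase s => arity s
    | EqHome => 1
    | EqIn _ => 1
    | EqProj E => (eqsize E).+1
    end).

Definition eqinterp M (s : symb (eqsig M)) :
    ('I_(arity s) -> M + imaginary M) -> Prop :=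
  match s return ('I_(@arity (eqsig M) s) -> M + imaginary M) -> Prop with
  | EqBase s => fun v =>
      exists2 a : 'I_(arity s) -> M, (forall i, v i = inl (a i)) & interp a
  | EqHome => fun v => exists a : M, v ord0 = inl a
  | EqIn E => fun v => exists2 e : imaginary M, v ord0 = inr e & imsort e = E
  | EqProj E => fun v =>
      exists2 a : 'I_(eqsize E) -> M,
        (forall i, v (lift ord0 i) = inl (a i)) & v ord0 = inr (im_proj a)
  end.

Definition Meq M : structure (eqsig M) :=
  @Structure (eqsig M) (M + imaginary M)%type (@eqinterp M).

End Logic.

Definition weak_canonical_parameter L (M : structure L) (e : Meq M)
    k (c : 'I_k -> M) : Prop :=
  (forall i, acl [set e] (inl (c i) : Meq M)) /\
  dcl (range (fun i => inl (c i) : Meq M)) e.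

(* [M] is meant to be a monster model of the theory under consideration. *)
Definition weak_EI L (M : structure L) : Prop :=
  forall e : Meq M, exists k (c : 'I_k -> M), weak_canonical_parameter e c.

(** * Urysohn monoids *)

Section UrysohnMonoid.
Context (R : distMonoid).

(* The symbol [r : R] stands for the binary relation [d(x,y) <= r]. *)
Definition dist_sig : signature := @Signature R (fun _ => 2).

Definition dist_structure (X : rmetric R) : structure dist_sig :=
  @Structure dist_sig X
    (fun r (v : 'I_2 -> X) => dle (dist (v ord0) (v ord_max)) r).

(* The Urysohn space exists and is unique up to isometry for countable [R], so
   quantifying over all of them fixes a single theory. *)
Definition urysohn_monoid : Prop :=
  countable [set: R] /\
  forall U : rmetric R, urysohn_space U ->
    quantifier_elimination (Th (dist_structure U)).

End UrysohnMonoid.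

(* Main.v *)
Require Import Defs.
From mathcomp Require Import all_boot all_algebra.
From mathcomp Require Import all_classical.
From mathcomp Require Import zify.

(** A distance in a model [M] of the theory of the Urysohn space [U] is a cut of
    [R]: only the upward closed set of the [r] with [d(x,y) <= r] is meaningful.
    By quantifier elimination the cuts between the entries of a finite tuple
    determine its type ([agree_tp]), and by saturation any finite configuration
    of cuts that obeys the triangle inequality and extends given points is
    realized ([realize]).  So the monster model is as homogeneous and as rich
    as [U], with cuts for distances, and the rest is geometry.

    Finite strong order rank makes multiples stabilize: an indiscernible
    sequence whose distances are multiples of [r] is not cyclic as long as
    [(n+3)r] exceeds [(n+1)r] ([SO_le_mulrn]).  Hence, for a fixed [n], every
    [e = (n+1)r] is idempotent and bounds all multiples of [r].

    If [R] is not archimedean, some such [e] with [r > 0] is not the greatest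
    element of [R].  Then [d(x,y) <= e] is an equivalence relation with several
    classes, and the orbit of any point under the automorphisms preserving a
    class is infinite.  So no element of [M] is algebraic over a class; but a
    class is not definable without parameters either, and it has no weak
    canonical parameter ([weak_EI_idempotent]).

    If [R] is archimedean, [e] is the greatest element of [R], for every
    [r > 0]: a sum of [n+1] nonzero distances is as large as possible.  Let [X]
    be a class of a definable equivalence relation, invariant under the
    automorphisms fixing [a] and under those fixing [b], two finite tuples with
    common part [c].  Move a point of [X] freely away from [b] over [a], then
    freely away from [a] over [b], and so on.  A short distance to [a] can only
    survive through a path that alternates between [a] and [b] without meeting
    [c], and such paths soon have maximal length, or through [c].  In the end
    the point is free from [a] over [c], so its type over [a] is determined by
    its type over [c]; therefore [X] is invariant under the automorphisms fixing
    [c] ([invariant_over_meet]).  It follows that a tuple of minimal length over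
    which [X] is invariant has a unique range.  Compactness turns invariance
    into definability of the class from the tuple, and uniqueness of the range
    into algebraicity of its entries over the class ([weak_EI_of_absorbing]). *)

Set Implicit Arguments.
Unset Strict Implicit.
Unset Printing Implicit Defensive.

Local Open Scope classical_set_scope.
Local Open Scope card_scope.

Import GRing.Theory.

(** * Definable predicates *)

Definition sumf A B T (a : A -> T) (b : B -> T) (x : A + B) : T :=
  match x with inl i => a i | inr j => b j end.

Section Definability.
Context (L : signature).
Implicit Types N : structure L.

Lemma sat_rename N V W (f : V -> W) (phi : fo_form L V) (a : W -> N) :
  sat (rename f phi) a <-> sat phi (a \o f).
Proof.
elim: phi W f a => {V} /= [V|V x y|V s v|V p IHp q IHq|V p IHp] W f a //.
  by rewrite IHp IHq.
have E b : oapp a b \o omap f = oapp (a \o f) b by apply/funext => -[].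
by split=> H b; [move/IHp: (H b)|apply/IHp]; rewrite ?E.
Qed.

Lemma qfree_rename V W (f : V -> W) (phi : fo_form L V) :
  qfree (rename f phi) = qfree phi.
Proof. by elim: phi W f => {V} //= V p IHp q IHq W f; rewrite IHp IHq. Qed.

(** Uniform definability over all structures: one formula has to work in the
    Urysohn space and in the monster model at the same time, and this is how
    facts are carried from one to the other. *)
Definition definable V (P : forall N, (V -> N) -> Prop) : Prop :=
  exists phi : fo_form L V, forall N a, sat phi a <-> P N a.

Lemma def_ext V (P Q : forall N, (V -> N) -> Prop) :
  definable P -> (forall N a, P N a <-> Q N a) -> definable Q.
Proof. by move=> [p Hp] H; exists p => N a; rewrite Hp. Qed.

Lemma def_sub V W (f : V -> W) (P : forall N, (V -> N) -> Prop) :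
  definable P -> definable (fun N (a : W -> N) => P N (a \o f)).
Proof. by move=> [p Hp]; exists (rename f p) => N a; rewrite sat_rename. Qed.

Lemma def_rel V s (v : 'I_(arity s) -> V) :
  definable (fun N a => interp (s := s) (a \o v)).
Proof. by exists (FRel v). Qed.

Lemma def_eq V (x y : V) : definable (fun N a => a x = a y).
Proof. by exists (FEq L x y). Qed.

Lemma def_imp V (P Q : forall N, (V -> N) -> Prop) :
  definable P -> definable Q -> definable (fun N a => P N a -> Q N a).
Proof. by move=> [p Hp] [q Hq]; exists (FImp p q) => N a /=; rewrite Hp Hq. Qed.

Lemma def_not V (P : forall N, (V -> N) -> Prop) :
  definable P -> definable (fun N a => ~ P N a).
Proof. by move=> [p Hp]; exists (FImp p (FBot L V)) => N a /=; rewrite Hp. Qed.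

Lemma def_true V : definable (fun N (a : V -> N) => True).
Proof. by exists (FImp (FBot L V) (FBot L V)) => N a /=; tauto. Qed.

Lemma def_and V (P Q : forall N, (V -> N) -> Prop) :
  definable P -> definable Q -> definable (fun N a => P N a /\ Q N a).
Proof.
move=> dP dQ.
apply: def_ext (def_not (def_imp dP (def_not dQ))) _ => N a /=; split; last tauto.
by move=> H; apply: contrapT => H'; apply: H => p q; apply: H'.
Qed.

(** For atoms [P] and [b] the truth of [P] in some structure, this allows the
    description of a diagram. *)
Lemma def_iff_const V (b : Prop) (P : forall N, (V -> N) -> Prop) :
  definable P -> definable (fun N a => P N a <-> b).
Proof.
move=> dP; have [Hb|Hb] := pselect b.
  by apply: def_ext dP _ => N a; tauto.
by apply: def_ext (def_not dP) _ => N a; tauto.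
Qed.

Lemma def_all V (P : forall N, (option V -> N) -> Prop) :
  definable P -> definable (fun N a => forall b, P N (oapp a b)).
Proof.
by move=> [p Hp]; exists (FAll p) => N a /=; split=> H b; apply/Hp/H.
Qed.

Lemma def_ex V (P : forall N, (option V -> N) -> Prop) :
  definable P -> definable (fun N a => exists b, P N (oapp a b)).
Proof.
move=> dP; apply: def_ext (def_not (def_all (def_not dP))) _ => N a; split.
  by move=> H; apply: contrapT => H'; apply: H => b Pb; apply: H'; exists b.
by move=> [b Pb] /(_ b).
Qed.

Lemma def_forall_seq V (I : eqType) (s : seq I)
    (P : I -> forall N, (V -> N) -> Prop) :
  (forall i, definable (P i)) ->
  definable (fun N a => forall i, i \in s -> P i N a).
Proof.
move=> dP; elim: s => [|i s IHs]; first by apply: def_ext (def_true V) _.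
apply: def_ext (def_and (dP i) IHs) _ => N a; split.
  by move=> [Pi Ps] j; rewrite inE => /predU1P[->//|/Ps].
by move=> H; split=> [|j js]; apply: H; rewrite inE ?eqxx ?js ?orbT.
Qed.

Lemma def_forall_fin V (I : finType) (P : I -> forall N, (V -> N) -> Prop) :
  (forall i, definable (P i)) -> definable (fun N a => forall i, P i N a).
Proof.
move=> /(def_forall_seq (enum I)) H; apply: def_ext H _ => N a.
by split=> [H i|H i _]; apply: H; rewrite ?mem_enum.
Qed.

(** Turns the first of the last [n.+1] variables into the variable [None], over
    which the logic can quantify. *)
Definition shift_var V n (x : V + 'I_n.+1) : option V + 'I_n :=
  match x with
  | inl v => inl (Some v)
  | inr i => if unlift ord0 i is Some j then inr j else inl None
  end.

Definition consf T n (b : T) (z : 'I_n -> T) (i : 'I_n.+1) : T :=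
  if unlift ord0 i is Some j then z j else b.

Lemma shift_varE T V n (a : V -> T) b (z : 'I_n -> T) :
  sumf (oapp a b) z \o @shift_var V n = sumf a (consf b z).
Proof. by apply/funext => -[v|i] //=; rewrite /consf; case: unliftP. Qed.

Lemma consfE T n (z : 'I_n.+1 -> T) :
  consf (z ord0) (fun i => z (lift ord0 i)) = z.
Proof. by apply/funext => i; rewrite /consf; case: unliftP => [j|] ->. Qed.

Lemma def_exn V n (P : forall N, (V + 'I_n -> N) -> Prop) :
  definable P ->
  definable (fun N a => exists z : 'I_n -> N, P N (sumf a z)).
Proof.
elim: n V P => [|n IHn] V P dP.
  pose f (x : V + 'I_0) : V :=
    match x with inl v => v | inr i => False_rect V (notF (valP i)) end.
  apply: def_ext (def_sub f dP) _ => N a.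
  have E z : sumf a z = a \o f.
    by apply/funext => -[//|i]; case: (notF (valP i)).
  split=> [H|[z]]; last by rewrite E.
  by exists (a \o f \o inr); rewrite E.
have dP' := IHn _ _ (def_sub (@shift_var V n) dP).
apply: def_ext (def_ex dP') _ => N a; split.
  by move=> [b [z]]; rewrite shift_varE => Pz; exists (consf b z).
by move=> [z Pz]; exists (z ord0), (fun i => z (lift ord0 i));
  rewrite shift_varE consfE.
Qed.

Lemma def_alln V n (P : forall N, (V + 'I_n -> N) -> Prop) :
  definable P ->
  definable (fun N a => forall z : 'I_n -> N, P N (sumf a z)).
Proof.
move=> dP; apply: def_ext (def_not (def_exn (def_not dP))) _ => N a; split.
  by move=> H z; apply: contrapT => Pz; apply: H; exists z.
by move=> H [z] /(_ (H z)).
Qed.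

(** [Th N0] speaks of closed formulas only, whence the quantified tuple. *)
Lemma transfer N0 N n (P : forall N, ('I_n -> N) -> Prop) :
  models (Th N0) N -> definable P ->
  (forall z, P N0 z) -> forall z, P N z.
Proof.
move=> NT dP H z.
have [p Hp] := def_alln (def_sub (inr : 'I_n -> void + 'I_n) dP).
by apply/((Hp N (of_void N)).1 (NT p _)); apply/Hp => z'; apply: H.
Qed.

Lemma qe_fin (T : theory L) (V : finType) (P : forall N, (V -> N) -> Prop) :
  quantifier_elimination T -> definable P ->
  exists psi : fo_form L V, qfree psi /\
    forall N, models T N -> forall a, sat psi a <-> P N a.
Proof.
move=> QE [p Hp]; have [q [qf Hq]] := QE _ (rename enum_rank p).
exists (rename (@enum_val V predT) q); split=> [|N NT a].
  by rewrite qfree_rename.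
rewrite sat_rename -Hq // sat_rename Hp.
suff -> : (a \o @enum_val V predT) \o enum_rank = a by [].
by apply/funext => v /=; rewrite enum_rankK.
Qed.

(** * Saturation for finite tuples *)

Lemma card_lt_fin (V : finType) (K : Type) : card_lt nat K -> card_lt V K.
Proof.
move=> natK; have Vnat : [set: V] #<= [set: nat] by apply: finite_set_countable.
split=> [|KV]; first exact: card_le_trans Vnat natK.1.
by apply: natK.2; apply: card_le_trans KV Vnat.
Qed.

Lemma finite_bounded T (F : set T) (P : nat -> T -> Prop) :
  finite_set F -> (forall x, F x -> exists n, P n x) ->
  exists m, forall x, F x -> exists2 n, (n <= m)%N & P n x.
Proof.
move=> finF H.
have /choice[f Hf] : forall x, exists n, F x -> P n x.
  by move=> x; have [/H[n]|nF] := pselect (F x); [exists n|exists 0%N].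
have /finite_seqP[s Es] := finite_image f finF.
exists (\max_(i <- s) i) => x Fx; exists (f x); last exact: Hf.
apply: leq_bigmax_seq => //.
by have : [set` s] (f x) by rewrite -Es; exists x.
Qed.

(** A partial type presented as a decreasing sequence of definable sets is
    finitely satisfiable as soon as each of them is nonempty; the signature is
    countable wherever this is applied. *)
Lemma saturated_chain1 (K : Type) N (V : Type) (b : V -> N)
    (D : nat -> forall N, (option V -> N) -> Prop) :
  saturated K N -> card_lt V K -> (forall n, definable (D n)) ->
  (forall n m (a : option V -> N), (n <= m)%N -> D m N a -> D n N a) ->
  (forall n, exists x, D n N (oapp b x)) ->
  exists x, forall n, D n N (oapp b x).
Proof.
move=> satN VK dD antiD H.
have /choice[phi Hphi] := dD.
have [|x Hx] := satN V b VK (range phi).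
  move=> F finF FS.
  have [m Hm] := finite_bounded (P := fun n x => phi n = x) finF
    (fun x Fx => let: ex_intro2 n _ e := FS x Fx in ex_intro _ n e).
  have [x Dx] := H m; exists x => f /Hm[n nm <-].
  exact/Hphi/(antiD _ _ _ nm).
by exists x => n; apply/Hphi/Hx; exists n.
Qed.

(** One variable is realized at a time, and joins the parameters. *)
Lemma saturated_chain (K : Type) N (V : finType) k (b : V -> N)
    (D : nat -> forall N, (V + 'I_k -> N) -> Prop) :
  card_lt nat K -> saturated K N -> (forall n, definable (D n)) ->
  (forall n m (a : V + 'I_k -> N), (n <= m)%N -> D m N a -> D n N a) ->
  (forall n, exists z, D n N (sumf b z)) ->
  exists z, forall n, D n N (sumf b z).
Proof.
move=> natK satN; elim: k V b D => [|k IHk] V b D dD antiD H.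
  have [z0 _] := H 0%N; exists z0 => n; have [z] := H n.
  by have -> // : z = z0 by apply/funext => i; case: (notF (valP i)).
pose D1 n := fun N (a : option V + 'I_k -> N) => D n N (a \o @shift_var V k).
pose D2 n := fun N (a : option V -> N) => exists z, D1 n N (sumf a z).
have dD1 n : definable (D1 n) by apply: def_sub.
have [||n|x Hx] := @saturated_chain1 K N V b D2 satN (card_lt_fin V natK).
- by move=> n; apply: def_exn.
- by move=> n m a nm [z Dz]; exists z; apply: antiD Dz.
- have [z Dz] := H n; exists (z ord0), (fun i => z (lift ord0 i)).
  by rewrite /D1 shift_varE consfE.
have [n m a nm|z Hz] := IHk (option V : finType) (oapp b x) D1 dD1 _ Hx.
  exact: antiD.
by exists (consf x z) => n; rewrite -shift_varE; apply: Hz.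
Qed.

(** * Satisfaction and bijections *)

(** A bijection between two structures, presented as a relation: this spares
    the construction of inverses, in particular on the imaginary sorts. *)
Lemma sat_bijection N N' (H : N -> N' -> Prop) :
  (forall x, exists y, H x y) -> (forall y, exists x, H x y) ->
  (forall x y x' y', H x y -> H x' y' -> (x = x' <-> y = y')) ->
  (forall s (v : 'I_(arity s) -> N) (w : 'I_(arity s) -> N'),
     (forall i, H (v i) (w i)) -> (interp v <-> interp w)) ->
  forall V (phi : fo_form L V) a a',
    (forall v, H (a v) (a' v)) -> (sat phi a <-> sat phi a').
Proof.
move=> Hl Hr Heq Hint V.
elim=> {V} /= [V|V x y|V s v|V p IHp q IHq|V p IHp] a a' Ha //.
- exact: Heq.
- by apply: Hint => i.
- by rewrite (IHp _ _ Ha) (IHq _ _ Ha).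
split=> Hp b.
  have [c Hcb] := Hr b.
  by apply: (IHp (oapp a c) (oapp a' b) _).1 (Hp c) => -[v|] /=.
have [c Hbc] := Hl b.
by apply: (IHp (oapp a b) (oapp a' c) _).2 (Hp c) => -[v|] /=.
Qed.

Lemma sat_automorphism N (g : N -> N) V (phi : fo_form L V) a :
  automorphism g -> (sat phi (g \o a) <-> sat phi a).
Proof.
move=> [gi gs gr].
apply: iff_sym; apply: (@sat_bijection N N (fun x y => y = g x)) => //.
- by move=> x; exists (g x).
- by move=> y; have [x <-] := gs y; exists x.
- by move=> x _ x' _ -> ->; split=> [->|/gi].
move=> s v w Hw; rewrite -gr.
by have -> : w = fun i => g (v i) by apply/funext.
Qed.

End Definability.

(** * Arithmetic in a distance monoid *)

Section DistMonoid.
Context (R : distMonoid).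
Implicit Types r s t : R.

Lemma dleD r s r' s' : dle r r' -> dle s s' -> dle (r + s)%R (r' + s')%R.
Proof.
move=> rr' ss'; apply: (dle_trans (dle_add2r s rr')).
by rewrite ![(r' + _)%R]addrC; apply: dle_add2r.
Qed.

Lemma dleDr r s : dle r (r + s)%R.
Proof. by rewrite -{1}[r]addr0 dleD ?dle_refl ?dle0r. Qed.

Lemma dleDl r s : dle r (s + r)%R.
Proof. by rewrite addrC dleDr. Qed.

Lemma dleMn r s n : dle r s -> dle (r *+ n)%R (s *+ n)%R.
Proof. by move=> rs; elim: n => [|n IHn]; rewrite ?dle_refl // !mulrS dleD. Qed.

Lemma dleMnn r m n : (m <= n)%N -> dle (r *+ m)%R (r *+ n)%R.
Proof. by move=> /subnKC <-; rewrite mulrnDr dleDr. Qed.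

Lemma dle_le0 r : dle r 0%R -> r = 0%R.
Proof. by move=> r0; apply: dle_anti; rewrite r0 dle0r. Qed.

Lemma dleNle r s : ~ dle r s -> dle s r.
Proof. by move=> rs; case/orP: (dle_total r s). Qed.

Definition dmin r s : R := if dle r s then r else s.

Lemma dmin_lel r s : dle (dmin r s) r.
Proof. by rewrite /dmin; case: ifP => [_|/negbT/negP/dleNle//]; apply: dle_refl. Qed.

Lemma dmin_ler r s : dle (dmin r s) s.
Proof. by rewrite /dmin; case: ifP => // _; apply: dle_refl. Qed.

Lemma dmin_case (P : R -> Prop) r s : P r -> P s -> P (dmin r s).
Proof. by rewrite /dmin; case: ifP. Qed.

Lemma dminC r s : dmin r s = dmin s r.
Proof.
rewrite /dmin; case: ifP => [rs|/negbT/negP/dleNle ->//].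
by case: ifP => // sr; apply: dle_anti; rewrite rs.
Qed.

Lemma seq_min (p : set R) (l : seq R) :
  (exists2 r, r \in l /\ p r & forall s, s \in l -> p s -> dle r s) \/
  (forall s, s \in l -> ~ p s).
Proof.
elim: l => [|t l IHl]; first by right.
have [pt|npt] := pselect (p t); last first.
  case: IHl => [[r [rl pr] rmin]|H]; [left; exists r|right].
  - by rewrite inE rl orbT.
  - by move=> s /predU1P[->//|]; apply: rmin.
  - by move=> s /predU1P[->//|]; apply: H.
left; case: IHl => [[r [rl pr] rmin]|H]; last first.
  exists t; first by rewrite inE eqxx.
  by move=> s /predU1P[-> _|/H//]; apply: dle_refl.
exists (dmin t r).
  split; last exact: dmin_case.
  by apply: (dmin_case (P := fun x => x \in t :: l)); rewrite inE ?eqxx ?rl ?orbT.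
move=> s /predU1P[-> _|sl ps]; first exact: dmin_lel.
by apply: (dle_trans (dmin_ler _ _)); apply: rmin.
Qed.

(** If every element of [R] lies below some entry of [l], the greatest entry
    of [l] is the greatest element of [R]. *)
Lemma seq_bound (l : seq R) :
  (exists t, forall r, r \in l -> ~ dle t r) \/
  (exists2 m, m \in l & forall t, dle t m) \/ l = [::].
Proof.
elim: l => [|r l [[t Ht]|[[m ml Hm]|->]]]; first by right; right.
- have [tr|ntr] := pselect (dle t r); last first.
    by left; exists t => s /predU1P[->//|/Ht].
  have [[t' Ht']|Hmax] := pselect (exists t', ~ dle t' r).
    left; exists t' => s /predU1P[->//|/Ht ts t's]; apply: ts.
    exact: dle_trans (dle_trans tr (dleNle Ht')) t's.
  right; left; exists r; first by rewrite inE eqxx.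
  by move=> t'; apply: contrapT => H; apply: Hmax; exists t'.
- by right; left; exists m; rewrite // inE ml orbT.
have [[t' Ht']|Hmax] := pselect (exists t', ~ dle t' r).
  by left; exists t' => s; rewrite inE => /eqP ->.
right; left; exists r; first by rewrite inE eqxx.
by move=> t'; apply: contrapT => H; apply: Hmax; exists t'.
Qed.

End DistMonoid.

(** * Distances as cuts *)

(** In a nonstandard model a distance need not lie in [R]; what is left of it
    is the upward closed set of the [r] with [d(x,y) <= r].  [P x y r] reads
    [d(x,y) <= r], and sums of distances become sums of sets.  Distinct points
    may be at distance [0], so that points can be prescribed without deciding
    which of them coincide. *)
Record cut_metric (R : distMonoid) (X : Type) (P : X -> X -> R -> Prop) : Prop :=
  CutMetric {
    cut_refl : forall x r, P x x r;
    cut_sym : forall x y r, P x y r -> P y x r;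
    cut_up : forall x y r s, dle r s -> P x y r -> P x y s;
    cut_tri : forall x y z r s, P x y r -> P y z s -> P x z (r + s)%R;
    cut_max : forall x y m, (forall t, dle t m) -> P x y m
  }.

Section Approximation.
Context (R : distMonoid) (X : finType) (P : X -> X -> R -> Prop).
Hypothesis PM : cut_metric P.
Variable l : seq R.
Hypothesis l0 : 0%R \in l.

(** The admissible values for an approximation on [l].  The second case is
    there for empty cuts, that is, infinite distances, which no element of [R]
    belongs to. *)
Let Q x y t : Prop := P x y t \/ forall r, r \in l -> ~ dle t r.

Let QD x y z t u : Q x y t -> Q y z u -> Q x z (t + u)%R.
Proof.
case=> Ht; last first.
  by move=> _; right => r /Ht tr tur; apply: tr; apply: dle_trans (dleDr _ _) tur.
case=> Hu; first by left; apply: cut_tri Hu.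
by right => r /Hu tr tur; apply: tr; apply: dle_trans (dleDl _ _) tur.
Qed.

Let good (d : X -> X -> R) : Prop :=
  [/\ forall x y, d x y = d y x, forall x, d x x = 0%R,
      forall x y, Q x y (d x y)
    & forall x y r, r \in l -> P x y r -> dle (d x y) r].

Let good0 : exists d, good d.
Proof.
have H (xy : X * X) : exists t,
    Q xy.1 xy.2 t /\ forall r, r \in l -> P xy.1 xy.2 r -> dle t r.
  have [[r [rl Pr] rmin]|nP] := seq_min (P xy.1 xy.2) l.
    by exists r; split=> //; left.
  have [[t Ht]|[[m ml mmax]|l_nil]] := seq_bound l.
  - by exists t; split=> [|r /nP//]; right.
  (* the greatest element of [R] belongs to all cuts *)
  - by case: (nP m ml); apply: cut_max.
  - by move: l0; rewrite l_nil.
have [f Hf] := choice H.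
exists (fun x y => dmin (f (x, y)) (f (y, x))); split=> [x y|x|x y|x y r rl Pr].
- exact: dminC.
- apply: dle_le0; apply: (dmin_case (P := fun t => dle t 0%R)).
    by apply: (Hf (x, x)).2 => //; apply: cut_refl.
  by apply: (Hf (x, x)).2 => //; apply: cut_refl.
- apply: dmin_case; first exact: (Hf (x, y)).1.
  case: (Hf (y, x)).1 => /= H1; [left|right] => //.
  exact: (cut_sym PM).
- by apply: dle_trans (dmin_lel _ _) _; apply: (Hf (x, y)).2.
Qed.

(** Shortening by paths through [k] preserves the triangle inequalities at the
    points treated before, as in the Floyd-Warshall algorithm. *)
Let relax (d : X -> X -> R) (k : X) (x y : X) : R :=
  dmin (d x y) (d x k + d k y)%R.

Let good_relax d k : good d -> good (relax d k).
Proof.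
move=> [ds d0 dQ dl]; split=> [x y|x|x y|x y r rl Pr].
- by rewrite /relax ds (ds k) (ds x k) addrC.
- by apply: dle_le0; rewrite -[X in dle _ X](d0 x) dmin_lel.
- by apply: dmin_case => //; apply: (QD (dQ x k)).
- by apply: dle_trans (dmin_lel _ _) _; apply: dl.
Qed.

Let floyd_warshall (ks : seq X) : exists2 d, good d &
  forall k, k \in ks -> forall x y, dle (d x y) (d x k + d k y)%R.
Proof.
elim: ks => [|k ks [d gd dks]]; first by have [d] := good0; exists d.
have [ds d0 _ _] := gd.
have rk x : relax d k x k = d x k.
  by rewrite /relax d0 addr0 /dmin if_same.
have kr x : relax d k k x = d k x.
  by rewrite /relax d0 add0r /dmin if_same.
exists (relax d k) => [|v]; first exact: good_relax.
rewrite inE => /predU1P[->|vks] x y; first by rewrite rk kr dmin_ler.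
have dv := dks v vks.
have viak : dle (relax d k x y) (d x k + d k y)%R by apply: dmin_ler.
rewrite [relax d k x v]/relax [relax d k v y]/relax.
apply: (dmin_case (P := fun t => dle _ (t + _)%R));
  apply: (dmin_case (P := fun t => dle _ (_ + t)%R)).
- exact: dle_trans (dmin_lel _ _) (dv _ _).
- apply: dle_trans viak _; rewrite addrA; apply: dleD; last exact: dle_refl.
  exact: dv.
- apply: dle_trans viak _; rewrite -addrA; apply: dleD; first exact: dle_refl.
  exact: dv.
- apply: dle_trans viak _; apply: dleD; first exact: dleDr.
  exact: dleDl.
Qed.

(** Arbitrary choices in the cuts need not satisfy the triangle inequality, but
    the shortest path metric of such choices does.  It is still a choice in the
    cuts, because [cut_tri] keeps the lengths of paths in them; and it has the
    right trace on [l], because paths only decrease distances. *)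
Lemma approx_metric : exists d : X -> X -> R,
  [/\ forall x y, d x y = d y x, forall x, d x x = 0%R,
      forall x y z, dle (d x z) (d x y + d y z)%R
    & forall x y r, r \in l -> (dle (d x y) r <-> P x y r)].
Proof.
have [d [ds d0 dQ dl] dtri] := floyd_warshall (enum X).
exists d; split=> // [x y z|x y r rl]; first by apply: dtri; rewrite mem_enum.
split=> [dr|]; last exact: dl.
by case: (dQ x y) => [|/(_ r rl)//]; apply: cut_up.
Qed.

End Approximation.

(** A finite pseudometric embeds, through its metric quotient. *)
Lemma urysohn_pseudo (R : distMonoid) (U : rmetric R) (X : finType)
    (d : X -> X -> R) :
  urysohn_space U ->
  (forall x y, d x y = d y x) -> (forall x, d x x = 0%R) ->
  (forall x y z, dle (d x z) (d x y + d y z)%R) ->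
  exists u : X -> U, forall x y, dist (u x) (u y) = d x y.
Proof.
move=> [_ _ Uuniv] ds d0 dt.
pose root x := odflt x [pick y | d x y == 0%R].
have d_root x : d x (root x) = 0%R.
  by rewrite /root; case: pickP => [y /eqP|_] /=; rewrite ?d0.
have d_eq x y z : d x y = 0%R -> d x z = d y z.
  move=> xy; apply: dle_anti; apply/andP; split.
    by have := dt x y z; rewrite xy add0r.
  by have := dt y x z; rewrite (ds y x) xy add0r.
have root_eq x y : d x y = 0%R -> root x = root y.
  move=> xy; rewrite /root (eq_pick (Q := fun z => d y z == 0%R)).
    by case: pickP => [//|/(_ y)]; rewrite d0 eqxx.
  by move=> z /=; rewrite (d_eq x y).
pose Y := {x : X | root x == x}.
pose dY (x y : Y) := d (val x) (val y).
have dY0 x y : dY x y = 0%R <-> x = y.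
  split=> [xy|->]; last exact: d0.
  by apply: val_inj; rewrite -(eqP (valP x)) -(eqP (valP y)); apply: root_eq.
pose YM := @RMetric R Y dY (fun x y => ds _ _) dY0 (fun x y z => dt _ _ _).
have [|f Hf] := Uuniv YM; first exact: (@finite_finset Y).
have rootP x : root (root x) == root x.
  by apply/eqP; apply: root_eq; rewrite ds d_root.
exists (fun x => f (exist _ (root x) (rootP x))) => x y.
rewrite Hf //= /dY /=.
by rewrite -(d_eq x) ?d_root // ds -(d_eq y) ?d_root // ds.
Qed.

Lemma approx_urysohn (R : distMonoid) (U : rmetric R) (X : finType)
    (P : X -> X -> R -> Prop) (l : seq R) :
  urysohn_space U -> cut_metric P ->
  exists u : X -> U, forall x y r, r \in l ->
    (dle (dist (u x) (u y)) r <-> P x y r).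
Proof.
move=> UU PM.
have [|d [ds d0 dt dP]] := @approx_metric R X P PM (0%R :: l).
  by rewrite inE eqxx.
have [u Hu] := urysohn_pseudo UU ds d0 dt.
by exists u => x y r rl; rewrite Hu dP // inE rl orbT.
Qed.

Lemma cut_metric_comp (R : distMonoid) X Y (f : Y -> X) (P : X -> X -> R -> Prop) :
  cut_metric P -> cut_metric (fun x y => P (f x) (f y)).
Proof.
case=> Pr Ps Pu Pt Pm; split=> [x r|x y r|x y r s|x y z r s|x y m].
- exact: Pr.
- exact: Ps.
- exact: Pu.
- exact: Pt.
- exact: Pm.
Qed.

(** The hypothesis makes [r *+ n.+1] absorb [r]. *)
Lemma mulrn_absorb (R : distMonoid) (r : R) n :
  dle (r *+ n.+3)%R (r *+ n.+1)%R -> forall k, dle (r *+ k)%R (r *+ n.+1)%R.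
Proof.
move=> H; elim=> [|k IHk]; first by rewrite mulr0n dle0r.
rewrite mulrSr; apply: dle_trans (dle_add2r r IHk) _.
rewrite -mulrSr; apply: dle_trans H.
by rewrite !mulrS; apply: dleD; [exact: dle_refl|exact: dleDl].
Qed.

(** * A metric on pairs *)

Section Zigzag.
Context (R : distMonoid).

Definition aligned (p q : nat * nat) : bool :=
  [|| (p.1 < q.1)%N && (p.2 < q.2)%N, (q.1 < p.1)%N && (q.2 < p.2)%N
    | (p.1 == q.1) && (p.2 == q.2)].

(** The trace on [nat * nat] of the path metric of the graph on [L * nat], for a
    dense order [L] without endpoints that contains [nat], whose edges join [(l, i)] to [(l', i+1)] for [l < l'].  Each edge
    changes the second coordinate by one, so that a path between points that
    are not aligned has at least one step in each direction.  The value depends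
    on the first coordinates through their order only: this is what makes the
    rows indiscernible. *)
Definition zigzag (p q : nat * nat) : nat :=
  (p.2 - q.2) + (q.2 - p.2) + (if aligned p q then 0 else 2).

Lemma zigzagxx p : zigzag p p = 0.
Proof. by rewrite /zigzag /aligned !eqxx !orbT subnn. Qed.

Lemma zigzagC p q : zigzag p q = zigzag q p.
Proof.
by rewrite /zigzag /aligned orbCA (eq_sym p.1) (eq_sym p.2) addnC [X in _ + X]addnC addnC.
Qed.

Lemma zigzag_triangle p q s : (zigzag p s <= zigzag p q + zigzag q s)%N.
Proof.
case: p q s => [l i] [l' i'] [l'' i'']; rewrite /zigzag /aligned /=.
by case: (ltngtP l l'); case: (ltngtP i i'); case: (ltngtP l' l'');
  case: (ltngtP i' i''); case: (ltngtP l l''); case: (ltngtP i i'') => /=; lia.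
Qed.

Lemma zigzag_cut (r : R) : cut_metric (fun p q t => dle (r *+ zigzag p q)%R t).
Proof.
split=> [p t|p q t|p q t u tu|p q s t u|p q m]; last exact.
- by rewrite zigzagxx mulr0n dle0r.
- by rewrite zigzagC.
- by move=> /dle_trans; apply.
move=> pt qu; apply: dle_trans (dleMnn _ (zigzag_triangle p q s)) _.
by rewrite mulrnDr dleD.
Qed.

End Zigzag.

(** * The language of distances *)

Definition pairf T (x y : T) : 'I_2 -> T := fun i => if i == ord0 then x else y.

Lemma pairfE T (v : 'I_2 -> T) : v = pairf (v ord0) (v ord_max).
Proof.
apply/funext => i; rewrite /pairf; case: eqP => [->//|].
case: i => [[|[|//]]] Hi // H; first by case: H; apply: val_inj.
by congr v; apply: val_inj.
Qed.

Definition dleq (R : distMonoid) (N : structure (dist_sig R)) (r : R) (x y : N) : Prop :=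
  @interp (dist_sig R) N r (pairf x y).

Section DistLanguage.
Context (R : distMonoid).
Implicit Types N : structure (dist_sig R).

Lemma comp_pairf T T' (f : T -> T') x y : f \o pairf x y = pairf (f x) (f y).
Proof. by apply/funext => i; rewrite /pairf /=; case: ifP. Qed.

Definition atom V (r : R) (x y : V) : fo_form (dist_sig R) V :=
  @FRel (dist_sig R) V r (pairf x y).

Lemma sat_atom N V r (x y : V) (a : V -> N) :
  sat (atom r x y) a <-> dleq r (a x) (a y).
Proof. by rewrite /dleq -comp_pairf. Qed.

Lemma rename_atom V W (f : V -> W) r x y :
  rename f (atom r x y) = atom r (f x) (f y).
Proof. by rewrite /atom -comp_pairf. Qed.

Lemma def_dleq V (r : R) (x y : V) :
  definable (L := dist_sig R) (fun N a => dleq r (a x) (a y)).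
Proof.
by exists (atom r x y) => N a; apply: sat_atom.
Qed.

Lemma dleq_metric (X : rmetric R) r (x y : dist_structure X) :
  dleq r x y <-> dle (dist (x : X) y) r.
Proof. by []. Qed.

(** For finite [l] this is what a quantifier-free formula sees of a tuple; for
    [l] the whole of [R] it is, under quantifier elimination, equality of
    types. *)
Definition agree_on (l : set R) V N N' (a : V -> N) (b : V -> N') : Prop :=
  forall r, l r -> forall x y, dleq r (a x) (a y) <-> dleq r (b x) (b y).

Lemma qfree_agree V (phi : fo_form (dist_sig R) V) : qfree phi ->
  exists l : seq R, forall N N' (a : V -> N) (b : V -> N'),
    (forall x y, a x = a y <-> b x = b y) ->
    agree_on [set` l] a b -> (sat phi a <-> sat phi b).
Proof.
elim: phi => {V} [V|V x y|V s v|V p IHp q IHq|//] /=.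
- by move=> _; exists [::].
- by move=> _; exists [::] => N N' a b H _; apply: H.
- move=> _; exists [:: s] => N N' a b _ H.
  have E N0 (c : V -> N0) :
      interp (s := s) (fun i => c (v i)) <-> dleq s (c (v ord0)) (c (v ord_max)).
    by rewrite /dleq -comp_pairf -pairfE.
  by rewrite !E; apply: H; rewrite /= inE.
move=> /andP[/IHp[lp Hp] /IHq[lq Hq]]; exists (lp ++ lq) => N N' a b H0 H.
rewrite (Hp N N' a b) // ?(Hq N N' a b) // => r rl; apply: H.
  by rewrite /= mem_cat rl orbT.
by rewrite /= mem_cat rl.
Qed.

Lemma agree_sym l V N N' (a : V -> N) (b : V -> N') :
  agree_on l a b -> agree_on l b a.
Proof. by move=> H r lr x y; apply: iff_sym; apply: H. Qed.

Lemma agree_trans l V N N' N'' (a : V -> N) (b : V -> N') (c : V -> N'') :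
  agree_on l a b -> agree_on l b c -> agree_on l a c.
Proof. by move=> ab bc r lr x y; apply: iff_trans (ab r lr x y) (bc r lr x y). Qed.

Lemma agree_comp l V W N N' (f : W -> V) (a : V -> N) (b : V -> N') :
  agree_on l a b -> agree_on l (a \o f) (b \o f).
Proof. by move=> H r lr x y; apply: H. Qed.

(** Only the range of the parameters matters. *)
Lemma agree_params l V W n N (a : V -> N) (c : W -> N) (x y : 'I_n -> N) :
  (forall w, exists v, a v = c w) ->
  agree_on l (sumf a x) (sumf a y) -> agree_on l (sumf c x) (sumf c y).
Proof.
move=> /choice[f Hf] H.
pose g (v : W + 'I_n) : V + 'I_n := match v with inl w => inl (f w) | inr i => inr i end.
have E z : sumf c z = sumf a z \o g by apply/funext => -[w|i] /=.
by rewrite !E; apply: agree_comp.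
Qed.

End DistLanguage.

Lemma dleq_automorphism (R : distMonoid) (N : structure (dist_sig R)) (g : N -> N) r x y :
  automorphism g -> (dleq r (g x) (g y) <-> dleq r x y).
Proof. by move=> [_ _ grel]; rewrite /dleq -(comp_pairf g); apply: grel. Qed.

Lemma countable_enum (R : distMonoid) : countable [set: R] ->
  exists e : nat -> R, forall r, exists n, e n = r.
Proof.
move=> /countable_injP[f finj].
have /choice[e He] : forall n, exists r : R, forall s, f s = n -> s = r.
  move=> n; have [[r Hr]|nr] := pselect (exists r, f r = n); last first.
    by exists 0%R => s Hs; case: nr; exists s.
  by exists r => s Hs; apply: finj; rewrite ?in_setT // Hs.
by exists e => r; exists (f r); apply/esym/He.
Qed.

(** * Automorphisms and imaginaries *)

Section Meq.
Context (L : signature) (M : structure L).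

Lemma im_proj_eq (S : eqsort M) (a b : 'I_(eqsize S) -> M) :
  Defs.eqrel a b -> im_proj a = im_proj b.
Proof.
have [refl sym trans] := eqformP S => ab.
have E : [set c | Defs.eqrel a c] = [set c | Defs.eqrel b c].
  by apply/seteqP; split=> c /=; apply: trans => //; apply: sym.
rewrite /im_proj; move: (ex_intro _ a _) (ex_intro _ b _); rewrite E => p q.
by congr Imaginary; apply: Prop_irrelevance.
Qed.

(** The type of [imclass] depends on the sort, so an equality between imaginaries
    has to be tested through a transport along an equality of sorts. *)
Lemma im_proj_inj (S : eqsort M) (a b : 'I_(eqsize S) -> M) :
  im_proj a = im_proj b -> Defs.eqrel a b.
Proof.
pose mem (e : imaginary M) (c : 'I_(eqsize S) -> M) := forall E : S = imsort e,
  imclass (eq_rect S (fun S => 'I_(eqsize S) -> M) c _ E).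
have memE c d : mem (im_proj c) d <-> Defs.eqrel c d.
  split=> [/(_ erefl)//|cd E].
  by rewrite (Prop_irrelevance E erefl).
have [refl _ _] := eqformP S.
by move=> ab; apply/memE; rewrite ab; apply/memE; apply: refl.
Qed.

Lemma im_projP (e : imaginary M) :
  exists a : 'I_(eqsize (imsort e)) -> M, e = im_proj a.
Proof.
case: e => S X P /=; have [a E] := P; exists a; move: P; rewrite E => P.
by congr Imaginary; apply: Prop_irrelevance.
Qed.

Variable g : M -> M.
Hypothesis gaut : automorphism g.

Lemma eqrel_automorphism (S : eqsort M) (a b : 'I_(eqsize S) -> M) :
  Defs.eqrel (g \o a) (g \o b) <-> Defs.eqrel a b.
Proof.
apply: iff_trans (sat_automorphism _ _ gaut); rewrite /Defs.eqrel /rel_of_form.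
suff -> : g \o (fun x : bool * _ => if x.1 then b x.2 else a x.2) =
  fun x => if x.1 then (g \o b) x.2 else (g \o a) x.2 by [].
by apply/funext => -[[] i].
Qed.

(** The graph of the bijection of [M^eq] induced by [g]. *)
Definition eq_graph (x y : Meq M) : Prop :=
  match x, y with
  | inl u, inl v => v = g u
  | inr e, inr f => exists (S : eqsort M) (a : 'I_(eqsize S) -> M),
      e = im_proj a /\ f = im_proj (g \o a)
  | _, _ => False
  end.

Lemma im_sort_proj (S S' : eqsort M) (a : 'I_(eqsize S) -> M)
    (b : 'I_(eqsize S') -> M) : im_proj a = im_proj b -> S = S'.
Proof. by move=> /(congr1 (@imsort L M)). Qed.

Lemma eq_graph_l x : exists y, eq_graph x y.
Proof.
case: x => [u|e]; first by exists (inl (g u)).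
have [a ->] := im_projP e.
by exists (inr (im_proj (g \o a))); exists (imsort e), a.
Qed.

Lemma eq_graph_r y : exists x, eq_graph x y.
Proof.
have [_ gsurj _] := gaut.
case: y => [u|e]; first by have [v <-] := gsurj u; exists (inl v).
have [a ->] := im_projP e; have /choice[b Hb] := fun i => gsurj (a i).
exists (inr (im_proj b)), (imsort e), b; split=> //.
by have -> // : g \o b = a by apply/funext.
Qed.

Lemma eq_graph_fun x y x' y' :
  eq_graph x y -> eq_graph x' y' -> (x = x' <-> y = y').
Proof.
have [ginj _ _] := gaut.
have inr_inj (e f : imaginary M) : inr e = inr f :> Meq M -> e = f by case.
case: x x' y y' => [u|e] [u'|e'] [v|f] [v'|f'] //=.
  by move=> -> ->; split=> [[->]//|[/ginj->]].
move=> [S [a [-> ->]]] [S' [a' [-> ->]]]; split=> /inr_inj E.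
  have SS := im_sort_proj E; subst S'.
  by congr (inr _); apply/im_proj_eq/eqrel_automorphism/im_proj_inj.
have SS := im_sort_proj E; subst S'.
by congr (inr _); apply/im_proj_eq; move/im_proj_inj/eqrel_automorphism: E.
Qed.

Lemma eq_graph_interp s (v w : 'I_(@arity (eqsig M) s) -> Meq M) :
  (forall i, eq_graph (v i) (w i)) ->
  (@interp (eqsig M) (Meq M) s v <-> @interp (eqsig M) (Meq M) s w).
Proof.
have [_ _ grel] := gaut.
have home x y : eq_graph x y -> forall v, y = inl v -> exists u, x = inl u.
  by case: x y => [u|e] [u'|e'] //= _ v0 _; exists u.
case: s v w => [s||E|E] v w H /=.
- split=> -[a Ha sa].
    exists (g \o a); last exact/grel.
    by move=> i; move: (H i); rewrite Ha; case: (w i) => //= ? ->.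
  have /choice[b Hb] : forall i, exists u, v i = inl u.
    by move=> i; apply: home (H i) _ (Ha i).
  exists b => //; apply/grel; have -> // : (fun i => g (b i)) = a.
  by apply/funext => i; move: (H i); rewrite Ha Hb /= => ->.
- split=> -[a Ha].
    by move: (H ord0); rewrite Ha; case: (w ord0) => //= u _; exists u.
  exact: home (H ord0) _ Ha.
- split=> -[e He <-].
    move: (H ord0); rewrite He; case: (w ord0) => //= f [S [a [-> ->]]].
    by exists (im_proj (g \o a)).
  move: (H ord0); rewrite He; case: (v ord0) => //= f [S [a [-> ->]]].
  by exists (im_proj a).
- split=> -[a Ha a0].
    exists (g \o a).
      by move=> i; move: (H (lift ord0 i)); rewrite Ha; case: (w _) => //= ? ->.
    move: (H ord0); rewrite a0; case: (w ord0) => //= f [S [b [ab ->]]].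
    have SS := im_sort_proj ab; subst S.
    by congr (inr _); apply/im_proj_eq/eqrel_automorphism; move/esym/im_proj_inj: ab.
  have /choice[b Hb] : forall i, exists u, v (lift ord0 i) = inl u.
    by move=> i; apply: home (H _) _ (Ha i).
  have gb : g \o b = a.
    by apply/funext => i; move: (H (lift ord0 i)); rewrite Ha Hb /= => ->.
  exists b => //; move: (H ord0); rewrite a0; case: (v ord0) => //= f [S [c [-> ac]]].
  have SS := im_sort_proj ac; subst S.
  by congr (inr _); apply/im_proj_eq/eqrel_automorphism; rewrite gb;
    move/esym/im_proj_inj: ac.
Qed.

Lemma sat_eq_graph V (phi : fo_form (eqsig M) V) (a b : V -> Meq M) :
  (forall v, eq_graph (a v) (b v)) -> (sat phi a <-> sat phi b).
Proof.
apply: sat_bijection => [x|y|x y x' y'|s v w].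
- exact: eq_graph_l.
- exact: eq_graph_r.
- exact: eq_graph_fun.
- exact: eq_graph_interp.
Qed.

End Meq.

(** * Homogeneity and richness of the monster model *)

Section Monster.
Context (R : distMonoid) (U : rmetric R) (K : Type) (M : structure (dist_sig R)).
Implicit Types N : structure (dist_sig R).
Hypothesis urysohnR : urysohn_monoid R.
Hypothesis urysohnU : urysohn_space U.
Hypothesis monsterM : monster (Th (dist_structure U)) K M.

Let qeU : quantifier_elimination (Th (dist_structure U)).
Proof. exact: urysohnR.2. Qed.

Let modM : models (Th (dist_structure U)) M.
Proof. by case: monsterM. Qed.

Let modU : models (Th (dist_structure U)) (dist_structure U).
Proof. by []. Qed.

Let tuple3 T (x y z : T) (i : 'I_3) : T := nth x [:: x; y; z] i.

(** The existence of a greatest element of [R] is not expressed by a formula,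
    but if there is one, it bounds all the distances in [U]. *)
Lemma dleq_cut : cut_metric (fun (x y : M) r => dleq r x y).
Proof.
pose i0 : 'I_3 := ord0; pose i1 : 'I_3 := @Ordinal 3 1 erefl.
pose i2 : 'I_3 := @Ordinal 3 2 erefl.
have T := transfer (n := 3) modM.
split=> [x r|x y r|x y r s rs|x y z r s|x y m mmax].
- apply: (T _ (def_dleq r i0 i0) _ (tuple3 x x x)) => z.
  by apply/dleq_metric; rewrite (dist_eq0 _ _).2 ?dle0r.
- apply: (T _ (def_imp (def_dleq r i0 i1) (def_dleq r i1 i0)) _ (tuple3 x y y)).
  by move=> z; rewrite !dleq_metric dist_sym.
- apply: (T _ (def_imp (def_dleq r i0 i1) (def_dleq s i0 i1)) _ (tuple3 x y y)).
  by move=> z; rewrite !dleq_metric => /dle_trans; apply.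
- apply: (T _ (def_imp (def_dleq r i0 i1) (def_imp (def_dleq s i1 i2)
    (def_dleq (r + s)%R i0 i2))) _ (tuple3 x y z)) => w.
  rewrite !dleq_metric => Hr Hs; apply: dle_trans (dist_triangle _ (w i1) _) _.
  exact: dleD.
- apply: (T _ (def_dleq m i0 i1) _ (tuple3 x y y)) => z.
  exact/dleq_metric.
Qed.

Let MC := dleq_cut.

Lemma dleq0 (x y : M) : dleq 0%R x y -> x = y.
Proof.
pose i0 : 'I_2 := ord0; pose i1 : 'I_2 := ord_max.
apply: (transfer modM (def_imp (def_dleq 0%R i0 i1) (def_eq _ i0 i1)) _
  (pairf x y)) => z.
by rewrite dleq_metric => /dle_le0 /dist_eq0.
Qed.

Lemma agree_eq V (a : V -> M) (l : set R) X (b : V -> dist_structure X) :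
  l 0%R -> agree_on l a b -> forall x y, a x = a y <-> b x = b y.
Proof.
move=> l0 H x y; split=> [E|E].
  apply/(dist_eq0 (b x : X)); apply: dle_le0.
  by apply/dleq_metric/(H _ l0); rewrite E; apply: cut_refl MC _ _.
apply: dleq0; apply/(H _ l0)/dleq_metric.
by rewrite E (dist_eq0 _ _).2 ?dle0r.
Qed.

Lemma agree_eqM V (a b : V -> M) :
  agree_on setT a b -> forall x y, a x = a y <-> b x = b y.
Proof.
move=> H x y; split=> E; apply: dleq0; apply/H; rewrite // E;
  exact: (cut_refl MC).
Qed.

Lemma agree_sat (V : finType) (a b : V -> M) (P : forall N, (V -> N) -> Prop) :
  definable P -> agree_on setT a b -> (P M a <-> P M b).
Proof.
move=> dP H; have [psi [qf Hpsi]] := qe_fin qeU dP.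
have [l Hl] := qfree_agree qf.
rewrite -!Hpsi // (Hl M M a b) //; first exact: agree_eqM.
by move=> r _; apply: H.
Qed.

Lemma agree_tp (V : finType) (a b : V -> M) : agree_on setT a b -> tp a = tp b.
Proof.
move=> H; rewrite /tp; apply/seteqP; split=> phi /=.
  by apply: (agree_sat (P := fun N c => sat phi c) _ H).1; exists phi.
by apply: (agree_sat (P := fun N c => sat phi c) _ H).2; exists phi.
Qed.

Lemma agree_automorphism (V : finType) (a b : V -> M) :
  agree_on setT a b -> exists2 g : M -> M, automorphism g & forall v, g (a v) = b v.
Proof.
have [natK _ _ _ homM] := monsterM.
by move=> /agree_tp; apply: homM; apply: card_lt_fin.
Qed.

(** Every finite extension of a finite subset of [M] that the triangle
    inequality allows for cuts is realized in [M].  A finite part of the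
    extension problem only sees finitely many distances of the given points,
    because it is equivalent to a quantifier-free condition on them; hence it
    may be solved in [U] for nearby distances in [R]. *)
Lemma realize (V : finType) k (b : V -> M) (P : V + 'I_k -> V + 'I_k -> R -> Prop) :
  cut_metric P -> (forall r v w, P (inl v) (inl w) r <-> dleq r (b v) (b w)) ->
  exists z : 'I_k -> M, forall r x y,
    dleq r (sumf b z x) (sumf b z y) <-> P x y r.
Proof.
move=> PM Pb; have [e He] := countable_enum urysohnR.1.
pose D n N (a : V + 'I_k -> N) := forall i, i \in iota 0 n ->
  forall x y, dleq (e i) (a x) (a y) <-> P x y (e i).
have dD n : definable (D n).
  apply: def_forall_seq => i; apply: def_forall_fin => x.
  by apply: def_forall_fin => y; apply: def_iff_const; apply: def_dleq.
have [natK _ _ satM _] := monsterM.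
(* it remains to solve the first [n] conditions of the extension problem *)
have [|n|z Hz] := saturated_chain (b := b) natK satM dD; last first.
- exists z => r x y; have [n <-] := He r.
  by apply: (Hz n.+1 n); rewrite mem_iota add0n leqnn.
- have [psi [qf Hpsi]] := qe_fin qeU (def_exn (dD n)).
  have [l Hl] := qfree_agree qf.
  have [u Hu] := approx_urysohn (0%R :: l ++ map e (iota 0 n)) urysohnU PM.
  have bu : agree_on [set` 0%R :: l] b
      ((u : V + 'I_k -> dist_structure U) \o inl : V -> dist_structure U).
    move=> r /= rl x y; apply: iff_trans (iff_sym (Pb r x y)) (iff_sym (Hu _ _ _ _)).
    by move: rl; rewrite !inE mem_cat => /orP[->|->]; rewrite ?orbT.
  (* [u] approximates the given points along with the required ones *)
  apply/Hpsi => //; apply/(Hl _ _ _ _ _ _); last first.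
  + apply/(Hpsi (dist_structure U) modU); exists (u \o inr).
    suff : D n (dist_structure U) u.
      by congr (D n _ _); apply/funext => -[].
    by move=> i il x y; apply: Hu; rewrite inE mem_cat map_f ?orbT.
  + by move=> r rl; apply: bu; rewrite /= inE rl orbT.
  + by apply: agree_eq bu; rewrite /= inE eqxx.
- move=> n m a nm Dm i il; apply: Dm.
  by move: il; rewrite !mem_iota !add0n => /leq_trans; apply.
Qed.

Lemma monster_inhabited : exists x : M, True.
Proof.
have PM : cut_metric (fun (_ _ : void + 'I_1) (_ : R) => True) by split.
have [|z _] := realize (b := of_void M) PM; first by [].
by exists (z ord0).
Qed.

(** The points are realized one after the other, each over the previous ones. *)
Lemma realize_seq (P : nat -> nat -> R -> Prop) : cut_metric P ->
  exists x : nat -> M, forall r i j, dleq r (x i) (x j) <-> P i j r.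
Proof.
move=> PM; have [m0 _] := monster_inhabited.
pose upd (h : nat -> M) j v i := if i == j then v else h i.
pose good j (h : nat -> M) := forall r i i', (i < j)%N -> (i' < j)%N ->
  dleq r (h i) (h i') <-> P i i' r.
have /choice[next Hnext] : forall jh : nat * (nat -> M), exists v,
    good jh.1 jh.2 -> good jh.1.+1 (upd jh.2 jh.1 v).
  move=> [j h] /=; have [gh|] := pselect (good j h); last by exists m0.
  pose f (x : 'I_j + 'I_1) : nat := match x with inl i => i | inr _ => j end.
  have [r v w|z Hz] := realize
    (b := fun i : 'I_j => h i) (cut_metric_comp f PM).
    by rewrite gh.
  exists (z ord0) => _ r i i'.
  have E i0 : (i0 < j.+1)%N -> exists2 x, f x = i0 & sumf (fun i : 'I_j => h i) z x
      = upd h j (z ord0) i0.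
    rewrite ltnS leq_eqVlt /upd => /predU1P[->|i0j].
      by exists (inr ord0); rewrite //= eqxx.
    by exists (inl (Ordinal i0j)); rewrite //= ltn_eqF.
  by move=> /E[x <- <-] /E[y <- <-]; apply: Hz.
pose hs := fix hs j := if j is j'.+1 then upd (hs j') j' (next (j', hs j')) else fun _ => m0.
have ghs j : good j (hs j) by elim: j => // j IHj; apply: (Hnext (j, hs j)).
have stab i j : (i < j)%N -> hs j i = hs i.+1 i.
  elim: j => // j IHj; rewrite ltnS leq_eqVlt => /predU1P[->//|ij].
  by rewrite -IHj //= /upd ltn_eqF.
exists (fun i => hs i.+1 i) => r i j; pose m := (maxn i j).+1.
have im : (i < m)%N by rewrite ltnS leq_maxl.
have jm : (j < m)%N by rewrite ltnS leq_maxr.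
by rewrite -(stab i m) // -(stab j m) //; apply: ghs.
Qed.

(** * Strong order rank and multiples of a distance *)

(** The [l]-th tuple is [(l, 0), ..., (l, n+1)].  A cycle of [n+1] copies of
    this sequence would contain the path [(0, 0), (1, 1), ..., (n, n), (0, n+1)]
    whose steps have length [r], whereas [(0, 0)] and [(0, n+1)] are at distance
    [(n+3)r] for want of alignment. *)
Lemma SO_le_mulrn n : SO_le K M n ->
  forall r : R, dle (r *+ n.+3)%R (r *+ n.+1)%R.
Proof.
move=> SOn r.
pose pt (j : nat) := (j %/ n.+2, j %% n.+2)%N.
have [x Hx] := realize_seq (cut_metric_comp pt (zigzag_cut r)).
pose a (l : nat) (i : 'I_n.+2) := x (l * n.+2 + i)%N.
have Ha t l i l' i' :
    dleq t (a l i) (a l' i') <-> dle (r *+ zigzag (l, nat_of_ord i) (l', nat_of_ord i'))%R t.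
  by rewrite Hx /pt !divnMDl // !modnMDl !modn_small // !divn_small // !addn0.
have cardI : card_lt 'I_n.+2 K by case: monsterM => natK *; apply: card_lt_fin.
have inda : indiscernible a.
  move=> k u v hu hv; apply: (agree_tp
    (V := ('I_k * 'I_n.+2)%type)) => t _ [i i'] [j j'] /=.
  have mono (w : 'I_k -> nat) : {homo w : i j / (i < j)%N} ->
      ((w i < w j) = (i < j))%N * ((w j < w i) = (j < i))%N * ((w i == w j) = (i == j)).
    move=> hw; case: (ltngtP i j) => [/[dup] ij /hw H|/[dup] ij /hw H|/val_inj ->].
    - by rewrite H ltn_eqF // ltnNge ltnW //= -val_eqE /= ltn_eqF.
    - by rewrite H gtn_eqF // ltnNge ltnW //= -val_eqE /= gtn_eqF.
    - by rewrite ltnn !eqxx.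
  by rewrite !Ha /zigzag /aligned /= !(mono u hu) !(mono v hv).
have cyca := SOn _ a cardI inda.
(* the finite part of the cyclic type that says that the path closes up *)
apply: contrapT => Hr.
pose step (j : 'I_n.+1) : fo_form (dist_sig R) ('I_n.+1 * 'I_n.+2) :=
  atom r (j, inord j) (ordS j, inord j.+1).
pose far : fo_form (dist_sig R) ('I_n.+1 * 'I_n.+2) :=
  FImp (atom (r *+ n.+1)%R (ord0, ord0) (ord0, ord_max))
    (FBot (dist_sig R) _).
have [||z Hz] := cyca (range step `|` [set far]).
- rewrite finite_setU; split; last exact: finite_set1.
  by apply: finite_image; apply: finite_finset.
- move=> phi [[j _ <-]|->].
    exists j => //; exists (atom r (false, inord j) (true, inord j.+1)); last first.
      by rewrite rename_atom.
    have : dleq r (a 0 (inord j)) (a 1 (inord j.+1)).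
      have jn := ltn_ord j; rewrite Ha !inordK //; last exact: ltnW.
      by rewrite /zigzag /aligned /= ltnSn subSnn /= (eqP (leqnSn j)) dle_refl.
    by move=> H; apply/sat_atom.
  exists ord0 => //.
  exists (FImp (atom (r *+ n.+1)%R (false, ord0) (false, ord_max))
    (FBot (dist_sig R) _)); last first.
    rewrite /far -[atom _ (ord0, ord0) _](rename_atom
      (fun x : bool * 'I_n.+2 => (if x.1 then ordS ord0 else ord0 : 'I_n.+1, x.2))
      _ (false, ord0) (false, ord_max)).
    by [].
  have : ~ dleq (r *+ n.+1)%R (a 0 ord0) (a 0 ord_max).
    by rewrite Ha /zigzag /aligned /= sub0n subn0 add0n addn2.
  by move=> H /sat_atom.
have Fstep j : (range step `|` [set far]) (step j) by left; exists j.
have Ffar : (range step `|` [set far]) far by right.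
have Hstep (j : 'I_n.+1) : dleq r (z (j, inord j)) (z (ordS j, inord j.+1)).
  by apply/sat_atom/(Hz (step j))/Fstep.
have Hfar : ~ dleq (r *+ n.+1)%R (z (ord0, ord0)) (z (ord0, ord_max)).
  by move=> H; apply: (Hz far Ffar); apply/sat_atom.
have path j : (j <= n)%N -> dleq (r *+ j)%R (z (ord0, ord0)) (z (inord j, inord j)).
  elim: j => [|j IHj] jn.
    have -> : (inord 0, inord 0) = (ord0, ord0) :> 'I_n.+1 * 'I_n.+2.
      by congr pair; apply: val_inj; rewrite /= inordK.
    exact: (cut_refl MC).
  rewrite mulrSr; apply: (cut_tri MC) (IHj (ltnW jn)) _.
  have := Hstep (inord j).
  rewrite inordK ?ltnS ?(ltnW jn) //.
  have -> // : ordS (inord j) = inord j.+1 :> 'I_n.+1.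
  by apply: val_inj; rewrite /= !inordK ?modn_small // ltnS // ltnW.
apply: Hfar; rewrite mulrSr; apply: (cut_tri MC) (path n (leqnn n)) _.
have := Hstep (inord n).
rewrite inordK //.
have -> : ordS (inord n) = ord0 :> 'I_n.+1.
  by apply: val_inj; rewrite /= inordK // modnn.
have -> // : inord n.+1 = ord_max :> 'I_n.+2.
by apply: val_inj; rewrite /= inordK.
Qed.

(** * Idempotent distances and imaginaries *)

Lemma realize_at (s : R) (x : M) : exists y, forall r, dleq r x y <-> dle s r.
Proof.
pose f (v : unit + 'I_1) : bool := if v is inl _ then true else false.
have PM : cut_metric (fun (p q : bool) r => p = q \/ dle s r).
  split.
  - by left.
  - by move=> p q r [->|]; [left|right].
  - by move=> p q r t rt [->|sr]; [left|right; apply: dle_trans rt].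
  - move=> p q u r t [->|sr]; last by right; apply: dle_trans sr (dleDr _ _).
    by move=> [->|st]; [left|right; apply: dle_trans st (dleDl _ _)].
  - by move=> p q m; right.
have [r [] []|z Hz] := realize (b := fun _ => x)
  (cut_metric_comp f PM).
  by split=> _; [exact: (cut_refl MC)|left].
exists (z ord0) => r; have /= -> := Hz r (inl tt) (inr ord0).
by split=> [[]|]; [|done|right].
Qed.

(** The copies [z i] of [c] are conjugate to [c] over the class of [x] modulo
    [d(x,y) <= e]: if [c] is not in this class, they have the type of [c] over
    [x], and otherwise they are in the class as well.  Placing them at distance
    [max(d(c,x), e)] from [x] settles both cases at once. *)
Lemma realize_clones (e : R) (c x : M) n :
  exists z : 'I_n -> M,
    (forall r i j, dleq r (z i) (z j) <-> i = j \/ dle e r) /\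
    (forall r i, dleq r (z i) x <-> dleq r c x /\ dle e r).
Proof.
pose b (v : bool) := if v then c else x.
pose base (v : bool + 'I_n) := match v with inl v => b v | inr _ => c end.
pose old (v : bool + 'I_n) := if v is inl _ then true else false.
(* the maximum of [d(c,x)] and [e] is the intersection of the two cuts *)
pose P v w r := dleq r (base v) (base w) /\ [\/ old v && old w, v = w | dle e r].
have PM : cut_metric P.
  split.
  - by move=> v r; split; [exact: (cut_refl MC)|apply: Or32].
  - move=> v w r [Pvw E]; split; first exact: (cut_sym MC).
    by case: E => [|->|]; [rewrite andbC|..]; [apply: Or31|apply: Or32|apply: Or33].
  - move=> v w r s rs [Pvw E]; split; first exact: (cut_up MC) Pvw.
    by case: E => [|->|er]; [apply: Or31|apply: Or32|apply: Or33; apply: dle_trans rs].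
  - move=> v w u r s [Pvw E] [Pwu F]; split; first exact: (cut_tri MC) Pwu.
    case: E => [/andP[ov ow]|->|er].
    + case: F => [/andP[_ ou]|<-|es]; first by apply: Or31; rewrite ov ou.
        by apply: Or31; rewrite ov ow.
      by apply: Or33; apply: dle_trans es (dleDl _ _).
    + case: F => [|->|es]; [exact: Or31|exact: Or32|].
      by apply: Or33; apply: dle_trans es (dleDl _ _).
    + by apply: Or33; apply: dle_trans er (dleDr _ _).
  - by move=> v w m mmax; split; [exact: (cut_max MC)|apply: Or33].
have [r v w|z Hz] := realize (b := b) PM.
  by split=> [[]|H]; [|split; [|apply: Or31]].
exists z; split=> [r i j|r i].
  have /= -> := Hz r (inr i) (inr j); split=> [[_ [//|[->]|]]|]; [by left|by right|].
  move=> H; split; first exact: (cut_refl MC).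
  by case: H => [->|]; [apply: Or32|apply: Or33].
have /= -> := Hz r (inr i) (inl false).
by split=> [[H []]|[H er]] //; split=> //; apply: Or33.
Qed.

(** A definable equivalence relation [d(x,y) <= e] with infinitely many
    classes, all of them infinite, is not eliminated: no element of [M] is
    algebraic over a class, and no class is definable without parameters. *)
Lemma weak_EI_idempotent (e : R) :
  weak_EI M -> dle (e + e)%R e -> e <> 0%R -> forall s, dle s e.
Proof.
move=> wEI ee e0 s; apply: contrapT => nse.
have trans (x y z : M) : dleq e x y -> dleq e y z -> dleq e x z.
  by move=> xy yz; apply: (cut_up MC ee); apply: (cut_tri MC) yz.
have sym (x y : M) : dleq e x y -> dleq e y x by apply: (cut_sym MC).
pose near : fo_form (dist_sig R) (bool * 'I_1) := atom e (false, ord0) (true, ord0).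
have nearE (a b : 'I_1 -> M) : rel_of_form near a b <-> dleq e (a ord0) (b ord0).
  exact: sat_atom.
have nearP : equivalence (@rel_of_form _ M 1 near).
  split=> [a|a b|a b c].
  - by apply/nearE; apply: (cut_refl MC).
  - by rewrite !nearE; apply: sym.
  - by rewrite !nearE; apply: trans.
pose S := @EqSort _ M 1 near nearP.
pose cls (x : M) : imaginary M := @im_proj _ M S (fun _ => x).
have clsE x y : dleq e x y <-> cls x = cls y.
  split=> [xy|/im_proj_inj/nearE//].
  by apply: im_proj_eq; apply/nearE.
have inr_inj (i j : imaginary M) : inr i = inr j :> Meq M -> i = j by case.
have cls_graph g x : @eq_graph _ M g (inr (cls x)) (inr (cls (g x))).
  by exists S, (fun _ => x).
have [x _] := monster_inhabited.
have [[|k] [c [Hacl Hdcl]]] := wEI (inr (cls x)).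
  (* without parameters, the class of [x] is conjugate to that of a point [y]
     at distance [s] *)
  have [n [b [phi [Hb Hphi]]]] := Hdcl.
  have [y Hy] := realize_at s x.
  have xy : agree_on setT (fun _ : unit => x) (fun _ => y).
    by move=> r _ [] []; split=> _; apply: (cut_refl MC).
  have [g gaut gx] := agree_automorphism xy.
  have phix : [set z | sat phi (oapp b z)] (inr (cls x)) by rewrite Hphi.
  have phiy : [set z | sat phi (oapp b z)] (inr (cls y)).
    apply: (sat_eq_graph gaut phi _).1 phix => -[i|]; first by have [[]] := Hb i.
    by have /= <- := gx tt; apply: cls_graph.
  move: phiy; rewrite Hphi => /inr_inj/esym/clsE; rewrite Hy; exact: nse.
(* otherwise more conjugates of the first parameter over the class of [x] are
   found than the algebraic formula has solutions *)
have [n [b [phi [Hb phic Hfin]]]] := Hacl ord0.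
have /finite_setP[m /card_set_bijP[f [fm finj _]]] := Hfin.
have [z [zz zx]] := realize_clones e (c ord0) x m.+1.
have zsat i : sat phi (oapp b (inl (z i))).
  have [g gaut [gx gc]] : exists2 g : M -> M, automorphism g &
      cls (g x) = cls x /\ g (c ord0) = z i.
    have [cx|ncx] := pselect (dleq e (c ord0) x).
      have cz : agree_on setT (fun _ : unit => c ord0) (fun _ => z i).
        by move=> r _ [] []; split=> _; apply: (cut_refl MC).
      have [g gaut gc] := agree_automorphism cz.
      exists g => //; split; last exact: (gc tt).
      have gcx : dleq e (g (c ord0)) (g x) by apply/dleq_automorphism.
      apply/clsE/(trans _ (z i)); first by apply: sym; rewrite -(gc tt).
      by apply/zx; split=> //; apply: dle_refl.
    have cz : agree_on setT (fun v : bool => if v then c ord0 else x)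
        (fun v => if v then z i else x).
      have up r : dleq r (c ord0) x -> dle e r.
        by move=> cx; apply: dleNle => /(cut_up MC) re; apply/ncx/re.
      have xc r : dleq r (z i) x <-> dleq r (c ord0) x.
        by rewrite zx; split=> [[]//|cx]; split=> //; apply: up.
      have symI r (y y' : M) : dleq r y y' <-> dleq r y' y.
        by split; apply: (cut_sym MC).
      move=> r _ [] [] //=.
      - by split=> _; apply: (cut_refl MC).
      - exact: iff_sym (xc r).
      - exact: iff_trans (symI _ _ _) (iff_trans (iff_sym (xc r)) (symI _ _ _)).
    have [g gaut gc] := agree_automorphism cz.
    by exists g => //; split; [rewrite (gc false)|exact: (gc true)].
  apply: (sat_eq_graph gaut phi _).1 phic => -[j|] /=; last by rewrite gc.
  by rewrite (Hb j) -{2}gx.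
have zinj : injective z.
  move=> i j ij; have : dleq 0%R (z i) (z j) by rewrite ij; apply: (cut_refl MC).
  by move=> /zz[//|/dle_le0].
have fz_lt i : (f (inl (z i)) < m)%N by apply: fm.
have : injective (fun i => Ordinal (fz_lt i)).
  move=> i j [] /finj E; apply: zinj.
  by have [] : inl (z i) = inl (z j) :> Meq M by apply: E; rewrite inE.
by move=> /leq_card; rewrite !card_ord ltnn.
Qed.

Lemma weak_EI_archimedean : SO_finite K M -> weak_EI M -> archimedean R.
Proof.
move=> [n SOn] wEI r s /andP[r0 _] _.
have H := mulrn_absorb (SO_le_mulrn SOn r).
exists n.+1; split=> //; apply: weak_EI_idempotent => //.
  by rewrite -mulrnDr.
move=> E; move/eqP: r0; apply; apply/esym/dle_le0; rewrite -E.
exact: (H 1%N).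
Qed.

(** * Free moves and invariant sets *)

(** This is the situation of a bounded archimedean monoid: a sum of [k0] nonzero
    distances is maximal. *)
Section Absorbing.
Variables (m : R) (k0 : nat).
Hypothesis m_max : forall t, dle t m.
Hypothesis m_mulrn : forall r : R, r <> 0%R -> dle m (r *+ k0)%R.

(** The free amalgam of [x] and [b] over [a] gives [y i] and [b w] the largest
    distance that the paths through [a] allow, or [m] for lack of such paths. *)
Lemma free_move (V W : finType) n (a : V -> M) (b : W -> M) (x : 'I_n -> M) :
  exists y : 'I_n -> M, agree_on setT (sumf a x) (sumf a y) /\
    forall i w t, dleq t (y i) (b w) -> dle m t \/
      exists v r s, [/\ dleq r (x i) (a v), dleq s (a v) (b w) & dle (r + s)%R t].
Proof.
pose c := sumf a b.
(* for points of [a] this is the old distance, which is the shortest path *)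
pose G i v t := dle m t \/
  exists u r s, [/\ dleq r (x i) (a u), dleq s (a u) (c v) & dle (r + s)%R t].
pose P (p q : (V + W) + 'I_n) t := match p, q with
  | inl v, inl w => dleq t (c v) (c w)
  | inr i, inr j => dleq t (x i) (x j)
  | inl v, inr i | inr i, inl v => G i v t
  end.
have top t (y z : M) : dle m t -> dleq t y z.
  by move=> mt; apply: (cut_up MC mt); apply: (cut_max MC).
have Gup i v t t' : dle t t' -> G i v t -> G i v t'.
  move=> tt' [mt|[u [r [s [H1 H2 H3]]]]]; [left|right]; first exact: dle_trans tt'.
  by exists u, r, s; split=> //; apply: dle_trans tt'.
have Gc i v w t t' : G i v t -> dleq t' (c v) (c w) -> G i w (t + t')%R.
  move=> [mt|[u [r [s [H1 H2 H3]]]]] vw; [left|right].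
    exact: dle_trans (dleDr _ _).
  exists u, r, (s + t')%R; split=> //; first exact: (cut_tri MC) vw.
  by rewrite addrA; apply: dle_add2r.
have Gx i j v t t' : G i v t -> dleq t' (x j) (x i) -> G j v (t' + t)%R.
  move=> [mt|[u [r [s [H1 H2 H3]]]]] ji; [left|right].
    exact: dle_trans (dleDl _ _).
  exists u, (t' + r)%R, s; split=> //; first exact: (cut_tri MC) H1.
  by rewrite -addrA; apply: dleD => //; apply: dle_refl.
have Gi_c i v w t t' : G i v t -> G i w t' -> dleq (t + t')%R (c v) (c w).
  move=> [mt _|[u [r [s [H1 H2 H3]]]]].
    by apply: top; apply: dle_trans mt (dleDr _ _).
  move=> [mt'|[u' [r' [s' [H1' H2' H3']]]]].
    by apply: top; apply: dle_trans mt' (dleDl _ _).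
  apply: (cut_up MC (dleD H3 H3')); apply: (cut_tri MC (y := x i)).
    by apply: (cut_sym MC); apply: (cut_tri MC) H2.
  exact: (cut_tri MC) H2'.
have Gv_x i j v t t' : G i v t -> G j v t' -> dleq (t + t')%R (x i) (x j).
  move=> [mt _|[u [r [s [H1 H2 H3]]]]].
    by apply: top; apply: dle_trans mt (dleDr _ _).
  move=> [mt'|[u' [r' [s' [H1' H2' H3']]]]].
    by apply: top; apply: dle_trans mt' (dleDl _ _).
  apply: (cut_up MC (dleD H3 H3')); apply: (cut_tri MC (y := c v)).
    exact: (cut_tri MC) H2.
  by apply: (cut_sym MC); apply: (cut_tri MC) H2'.
have PM : cut_metric P.
  split.
  - by move=> [v|i] r; apply: (cut_refl MC).
  - by move=> [v|i] [w|j] r //=; apply: (cut_sym MC).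
  - by move=> [v|i] [w|j] r s /=; [apply: (cut_up MC)|apply: Gup|apply: Gup|apply: (cut_up MC)].
  - move=> [v|i] [w|j] [u|l] r s /=.
    + exact: (cut_tri MC).
    + by rewrite addrC => vw wl; apply: Gc wl _; apply: (cut_sym MC).
    + by move=> jv ju; apply: Gi_c ju.
    + by rewrite addrC => jv jl; apply: Gx jv _; apply: (cut_sym MC).
    + exact: Gc.
    + exact: Gv_x.
    + by move=> ij ju; apply: Gx ju ij.
    + exact: (cut_tri MC).
  - by move=> [v|i] [w|j] t tmax; [apply: top|left|left|apply: top].
have [//|y Hy] := realize (b := c) PM.
exists y; split=> [r _|i w t]; last first.
  by have -> := Hy t (inr i) (inl (inr w)).
have Gv i v : dleq r (x i) (a v) <-> G i (inl v) r.
  split=> [H|[mr|[u [s [t [H1 H2 H3]]]]]]; last 2 first.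
  - exact: top.
  - by apply: (cut_up MC H3); apply: (cut_tri MC) H2.
  right; exists v, r, 0%R; rewrite addr0; split=> //; last exact: dle_refl.
  exact: (cut_refl MC).
have swap (y1 y2 : M) : dleq r y1 y2 <-> dleq r y2 y1 by split; apply: (cut_sym MC).
move=> [v|i] [w|j] /=; first by [].
- apply: iff_trans (swap _ _) (iff_trans (Gv _ _) _).
  exact: iff_sym (Hy r (inl (inl v)) (inr j)).
- exact: iff_trans (Gv _ _) (iff_sym (Hy r (inr i) (inl (inl w)))).
- exact: iff_sym (Hy r (inr i) (inr j)).
Qed.

Section Invariance.
Variables (n : nat) (X : ('I_n -> M) -> Prop).

(** By homogeneity, invariance under the automorphisms that fix [a]. *)
Definition invariant_over V (a : V -> M) : Prop := forall x y : 'I_n -> M,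
  agree_on setT (sumf a x) (sumf a y) -> X x -> X y.

Lemma invariant_overE V (a : V -> M) (x y : 'I_n -> M) : invariant_over a ->
  agree_on setT (sumf a x) (sumf a y) -> (X x <-> X y).
Proof. by move=> Xa xy; split; apply: Xa => //; apply: agree_sym. Qed.

Lemma invariant_over_sub V W (a : V -> M) (c : W -> M) :
  (forall v, exists w, c w = a v) -> invariant_over a -> invariant_over c.
Proof. by move=> ac Xa x y xy; apply: Xa; apply: agree_params xy. Qed.

Section Meet.
Variables (W : finType) (c : W -> M).

(** What is remembered of a bound [t] on a path with [h] nonzero steps: the least
    step, counted [h] times.  The first case covers the maximal distances. *)
Let big h t : Prop := dle m t \/ exists2 r : R, r <> 0%R & dle (r *+ h)%R t.

(** [t] bounds the length of a path from [x i] to [a v] through [c]. *)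
Let via V (a : V -> M) (x : 'I_n -> M) i v t : Prop := exists w r s,
  [/\ dleq r (x i) (c w), dleq s (c w) (a v) & dle (r + s)%R t].

Let level V (a : V -> M) h (x y : 'I_n -> M) : Prop :=
  agree_on setT (sumf c x) (sumf c y) /\
  forall i v t, dleq t (y i) (a v) -> via a x i v t \/ big h t.

(** A free move over [a] makes the distances to [b] path lengths through [a].
    Paths that meet the common part [c] are of the first kind; the others gain
    a nonzero step, from a point of [a] to a different point of [b]. *)
Let level_step (V V' : finType) (a : V -> M) (b : V' -> M) h x y :
  (forall w, exists v, a v = c w) ->
  (forall v v', a v = b v' -> exists w, c w = a v) ->
  invariant_over a -> level a h x y ->
  exists y', (X y <-> X y') /\ level b h.+1 x y'.
Proof.
move=> ca abc Xa [xy Hy]; have [y' [yy' Hy']] := free_move a b y.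
exists y'; split; first exact: invariant_overE yy'.
split; first by apply: agree_trans xy _; apply: agree_params yy'.
move=> i v' t /Hy'[mt|[v [r [s [yr rs rst]]]]]; first by right; left.
case: (Hy _ _ _ yr) => [[w [r1 [s1 [H1 H2 H3]]]]|rbig].
  left; exists w, r1, (s1 + s)%R; split=> //; first exact: (cut_tri MC) rs.
  by apply: dle_trans rst; rewrite addrA; apply: dle_add2r.
have [vv'|vv'] := pselect (a v = b v').
  have [w wv] := abc _ _ vv'; left; exists w, r, s; split=> //; last by rewrite wv.
  by apply/(xy r I (inr i) (inl w)); rewrite /= wv.
have s0 : s <> 0%R by move=> E; apply: vv'; apply: dleq0; rewrite -E.
right; case: rbig => [mr|[q q0 qr]]; [left|right].
  by apply: dle_trans (dle_trans mr (dleDr _ _)) rst.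
exists (dmin q s); first exact: (dmin_case (P := fun t => t <> 0%R)).
apply: dle_trans rst; rewrite mulrSr; apply: dleD (dmin_ler _ _).
by apply: dle_trans qr; apply: dleMn (dmin_lel _ _).
Qed.

(** After enough free moves, in turn over [a] and over [b], only the paths
    through [c] are shorter than [m].  Then the type over [a] is determined by
    the type over [c], and invariance over [a] applies. *)
Lemma invariant_over_meet (V V' : finType) (a : V -> M) (b : V' -> M) :
  (forall w, exists v, a v = c w) -> (forall w, exists v, b v = c w) ->
  (forall v v', a v = b v' -> exists w, c w = a v) ->
  invariant_over a -> invariant_over b -> invariant_over c.
Proof.
move=> ca cb abc Xa Xb.
have bac v' v : b v' = a v -> exists w, c w = b v' by move=> E; rewrite E; apply: abc (esym E).
(* a free move over [a] followed by one over [b] brings two more steps *)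
have iter h x : exists y, (X x <-> X y) /\ level a h.*2 x y.
  elim: h => [|h [y [Xy ly]]].
    exists x; split=> //; split=> [//|i v t _]; right.
    have [m0|m0] := pselect (m = 0%R); [left|right]; first by rewrite m0 dle0r.
    by exists m; rewrite // mulr0n dle0r.
  have [z [Xz lz]] := level_step ca abc Xa ly.
  have [z' [Xz' lz']] := level_step cb bac Xb lz.
  by exists z'; rewrite Xy Xz.
have free x : exists y, [/\ X x <-> X y, agree_on setT (sumf c x) (sumf c y) &
    forall i v t, dleq t (y i) (a v) <-> via a x i v t \/ dle m t].
  have [y [Xy [xy ly]]] := iter k0 x; exists y; split=> // i v t; split.
    case/ly=> [|[mt|[r r0 rt]]]; [by left|by right|right].
    apply: dle_trans (m_mulrn r0) _; apply: dle_trans rt.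
    by apply: dleMnn; rewrite -addnn leq_addr.
  case=> [[w [r [s [H1 H2 H3]]]]|mt]; last first.
    by apply: (cut_up MC mt); apply: (cut_max MC).
  apply: (cut_up MC H3); apply: (cut_tri MC) H2.
  exact/(xy r I (inr i) (inl w)).
move=> x x' xx'; have [y [Xy xy Hy]] := free x; have [y' [Xy' xy' Hy']] := free x'.
rewrite Xy Xy'; apply: Xa => r _.
have swap (y1 y2 : M) : dleq r y1 y2 <-> dleq r y2 y1 by split; apply: (cut_sym MC).
have yy' : agree_on setT (sumf c y) (sumf c y').
  by apply: agree_trans (agree_trans (agree_sym xy) xx') xy'.
have via_eq i v t : via a x i v t <-> via a x' i v t.
  by split=> -[w [q [s [H1 H2 H3]]]]; exists w, q, s; split=> //;
    apply/(xx' q I (inr i) (inl w)).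
move=> [v|i] [w|j] //=.
- by rewrite swap Hy via_eq -Hy' swap.
- by rewrite Hy via_eq -Hy'.
- exact: (yy' r I (inr i) (inr j)).
Qed.

End Meet.

(** By [invariant_over_meet] the entries of [c] that occur in [c'] are enough;
    if some entry did not occur there, they would form a shorter tuple. *)
Lemma invariant_over_min k (c : 'I_k -> M) k' (c' : 'I_k' -> M) :
  (forall j (d : 'I_j -> M), invariant_over d -> (k <= j)%N) ->
  invariant_over c -> invariant_over c' -> forall i, exists j, c' j = c i.
Proof.
move=> kmin Xc Xc' i; apply: contrapT => nci.
pose W := {u : 'I_k | `[< exists j, c' j = c u >]}.
have Xd : invariant_over (c \o (val : W -> 'I_k)).
  apply: invariant_over_meet Xc Xc' => [w|w|u j uj].
  - by exists (val w).
  - exact/asboolP/(valP w).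
  - have Hu : `[< exists j, c' j = c u >] by apply/asboolP; exists j.
    by exists (exist _ u Hu).
have Xe : invariant_over ((c \o (val : W -> 'I_k)) \o (@enum_val W predT)).
  by apply: invariant_over_sub Xd => w; exists (enum_rank w); rewrite /= enum_rankK.
have := kmin _ _ Xe; apply/negP; rewrite -ltnNge card_sub.
rewrite -[X in (_ < X)%N]card_ord; apply: proper_card; apply/properP.
by split; [apply/fintype.subsetP|exists i => //; apply/asboolPn].
Qed.

End Invariance.
End Absorbing.

(** * Weak canonical parameters of classes *)

Lemma weak_EI_home (x : M) :
  exists k (c : 'I_k -> M), weak_canonical_parameter (inl x : Meq M) c.
Proof.
pose eq1 : fo_form (eqsig M) (option 'I_1) := FEq _ None (Some ord0).
have eq1E : [set y | sat eq1 (oapp (fun _ : 'I_1 => inl x : Meq M) y)] = [set inl x].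
  by apply/seteqP; split.
exists 1, (fun _ => x); split=> [i|]; exists 1, (fun _ => inl x), eq1.
  by split=> //; rewrite eq1E; apply: finite_set1.
by split=> // i; exists ord0.
Qed.

(** The type of [a] over [c] implies the definable set [X _ (a, x)], so by
    compactness a finite part of it does. *)
Lemma invariant_over_isolated n (X : forall N : structure (dist_sig R),
    ('I_n + 'I_n -> N) -> Prop) k (c : 'I_k -> M) (a : 'I_n -> M) :
  definable X ->
  invariant_over (fun x => X M (sumf a x)) c -> X M (sumf a a) ->
  exists l : seq R, forall x : 'I_n -> M,
    agree_on [set` l] (sumf c a) (sumf c x) -> X M (sumf a x).
Proof.
move=> dX Xc Xa; have [e He] := countable_enum urysohnR.1.
have [natK _ _ satM _] := monsterM.
(* the variables: the parameters [c] and [a], then those of the tuple sought *)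
pose new (p : 'I_k + 'I_n) : ('I_k + 'I_n) + 'I_n :=
  match p with inl i => inl (inl i) | inr j => inr j end.
pose both (p : 'I_n + 'I_n) : ('I_k + 'I_n) + 'I_n :=
  match p with inl i => inl (inr i) | inr j => inr j end.
have newE (z : 'I_n -> M) : sumf (sumf c a) z \o new = sumf c z.
  by apply/funext => -[].
have bothE (z : 'I_n -> M) : sumf (sumf c a) z \o both = sumf a z.
  by apply/funext => -[].
pose D i (N : structure (dist_sig R)) (f : ('I_k + 'I_n) + 'I_n -> N) :=
  (forall j, j \in iota 0 i -> forall p q, dleq (e j) (f (new p)) (f (new q)) <->
     dleq (e j) (sumf c a p) (sumf c a q)) /\ ~ X N (f \o both).
have dD i : definable (D i).
  apply: def_and; last exact/def_not/def_sub.
  apply: def_forall_seq => j; apply: def_forall_fin => p.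
  by apply: def_forall_fin => q; apply: def_iff_const; apply: def_dleq.
apply: contrapT => nl.
have [i j f ij|i|z Hz] := saturated_chain (b := sumf c a) natK satM dD.
- move=> [H nX]; split=> // i0 Hi0; apply: H.
  by move: Hi0; rewrite !mem_iota !add0n => /leq_trans; apply.
- apply: contrapT => nz; apply: nl; exists (map e (iota 0 i)) => x Hx.
  apply: contrapT => nX; apply: nz; exists x; split; last by rewrite bothE.
  move=> j ji p q; apply: iff_sym; apply: iff_trans (Hx (e j) _ p q) _.
    exact: map_f.
  by rewrite -newE.
have [_] := Hz 0; rewrite bothE; apply; apply: Xc Xa => r _ p q.
have [j <-] := He r; have [H _] := Hz j.+1.
apply: iff_sym; rewrite -newE; apply: H.
by rewrite mem_iota add0n leqnn.
Qed.

Let base r : eqsymb M := EqBase M (r : symb (dist_sig R)).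

Lemma base_dleq r (x y : M) :
  @interp (eqsig M) (Meq M) (base r) (pairf (inl x) (inl y)) <-> dleq r x y.
Proof.
split=> [[a Ha]|xy].
  suff -> : a = pairf x y by [].
  rewrite (pairfE a); congr pairf.
    by have [] := Ha ord0.
  by have [] := Ha ord_max.
by exists (pairf x y) => // i; rewrite /pairf; case: ifP.
Qed.

Section Class.
Variables (S : eqsort M) (a : 'I_(eqsize S) -> M) (k : nat) (c : 'I_k -> M).
Variable l : seq R.
Let n := eqsize S.

(** The formula that defines the class of [a], at [None], from the parameters
    [c], when [l] isolates enough of the type of [a] over [c].  The parameters
    are variables because [entry_of_type] quantifies over them. *)
Definition class_of_type (N : structure (eqsig M)) (f : option 'I_k -> N) : Prop :=
  exists x : 'I_n -> N,
    @interp (eqsig M) N (@EqProj _ M S) (consf (f None) x) /\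
    forall r, r \in l -> forall p q : 'I_k + 'I_n,
      @interp (eqsig M) N (base r)
        (pairf (sumf (f \o Some) x p) (sumf (f \o Some) x q)) <->
      dleq r (sumf c a p) (sumf c a q).

Lemma def_class_of_type : definable class_of_type.
Proof.
pose v : 'I_n.+1 -> option 'I_k + 'I_n := consf (inl None) inr.
pose w (p : 'I_k + 'I_n) : option 'I_k + 'I_n :=
  match p with inl i => inl (Some i) | inr j => inr j end.
apply: def_ext (def_exn (P := fun (N : structure (eqsig M)) (f : option 'I_k + 'I_n -> N) =>
  @interp (eqsig M) N (@EqProj _ M S) (f \o v) /\
  forall r, r \in l -> forall p q : 'I_k + 'I_n,
    @interp (eqsig M) N (base r) (f \o pairf (w p) (w q)) <->
    dleq r (sumf c a p) (sumf c a q)) _) _.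
  apply: def_and; first exact: (@def_rel (eqsig M) _ (@EqProj _ M S) v).
  apply: def_forall_seq => r; apply: def_forall_fin => p.
  apply: def_forall_fin => q; apply: def_iff_const.
  exact: (@def_rel (eqsig M) _ (base r) (pairf (w p) (w q))).
move=> N f.
have vE (x : 'I_n -> N) : sumf f x \o v = consf (f None) x.
  by apply/funext => i; rewrite /= /v /consf; case: unlift.
have wE (x : 'I_n -> N) p : sumf f x (w p) = sumf (f \o Some) x p by case: p.
split=> -[x [H1 H2]]; exists x; split.
- by rewrite -vE.
- by move=> r rl p q; rewrite -!wE -comp_pairf; apply: H2.
- by rewrite vE.
- by move=> r rl p q; rewrite comp_pairf !wE; apply: H2.
Qed.

Lemma class_of_typeE (f : option 'I_k -> Meq M) (w : 'I_k -> M) :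
  (forall i, f (Some i) = inl (w i)) ->
  class_of_type f <-> exists x : 'I_n -> M,
    f None = inr (im_proj x) /\ agree_on [set` l] (sumf c a) (sumf w x).
Proof.
move=> fw.
have E (x : 'I_n -> M) (y : 'I_n -> Meq M) p : y = (fun i => inl (x i)) ->
    sumf (f \o Some) y p = inl (sumf w x p) by move=> ->; case: p => //= i.
split=> [[y [[x Hx Hp] Hy]]|[x [fx Hx]]].
  have yx : y = fun i => inl (x i).
    by apply/funext => i; rewrite -Hx /consf liftK.
  exists x; split; first by rewrite -Hp /consf unlift_none.
  move=> r rl p q; apply: iff_sym; apply: iff_trans (Hy r rl p q).
  by rewrite !(E x) // base_dleq.
exists (fun i => inl (x i)); split.
  exists x; last by rewrite /consf unlift_none.
  by move=> i; rewrite /consf liftK.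
move=> r rl p q; rewrite !(E x) //.
by apply: iff_trans (base_dleq _ _ _) (iff_sym (Hx r rl p q)).
Qed.

(** The [i]-th entries, at [None], of the home tuples [w] that define the class
    at [Some ord0] as [c] defines the class of [a].  If the range of [c] is
    unique there are finitely many of them. *)
Definition entry_of_type i (N : structure (eqsig M)) (f : option 'I_1 -> N) : Prop :=
  exists w : 'I_k -> N,
    [/\ w i = f None,
        forall j, @interp (eqsig M) N (EqHome M) (fun _ => w j),
        class_of_type (oapp w (f (Some ord0)))
      & forall z, class_of_type (oapp w z) -> z = f (Some ord0)].

Lemma def_entry_of_type i : definable (entry_of_type i).
Proof.
pose g (v : option 'I_k) : option 'I_1 + 'I_k :=
  if v is Some j then inr j else inl (Some ord0).
pose h (v : option 'I_k) : option (option 'I_1 + 'I_k) :=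
  if v is Some j then Some (inr j) else None.
have dC := def_class_of_type.
have dU : definable (fun (N : structure (eqsig M)) (f : option 'I_1 + 'I_k -> N) =>
    forall z, class_of_type (oapp f z \o h) -> oapp f z None =
      oapp f z (Some (inl (Some ord0)))).
  apply: (def_all (P := fun (N : structure (eqsig M)) (f : option (option 'I_1 + 'I_k) -> N) =>
    class_of_type (f \o h) -> f None = f (Some (inl (Some ord0))))).
  apply: def_imp; first exact: def_sub.
  exact: def_eq.
have dH : definable (fun (N : structure (eqsig M)) (f : option 'I_1 + 'I_k -> N) =>
    forall j, @interp (eqsig M) N (EqHome M) (fun _ => f (inr j))).
  apply: def_forall_fin => j.
  exact: (@def_rel (eqsig M) _ (EqHome M) (fun _ => inr j)).
have dP := def_and (def_eq _ (inr i) (inl None))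
  (def_and dH (def_and (def_sub g dC) dU)).
apply: def_ext (def_exn dP) _ => N f.
have gE (w : 'I_k -> N) : sumf f w \o g = oapp w (f (Some ord0)).
  by apply/funext => -[].
have hE (w : 'I_k -> N) z : oapp (sumf f w) z \o h = oapp w z.
  by apply/funext => -[].
split=> -[w Hw]; exists w.
  by case: Hw => /= H1 [H2]; rewrite gE => -[H3 H4].
by case: Hw => H1 H2 H3 H4; split=> //; split=> //; rewrite gE.
Qed.

End Class.

(** A tuple [c] of minimal length over which the class is invariant is a weak
    canonical parameter.  The class is definable from [c] by compactness.  A
    tuple [w] from which it is defined by the same formula is also one over which
    it is invariant, so that the range of [w] is contained in that of [c]; this
    makes the entries of [c] algebraic over the class. *)
Lemma weak_EI_of_absorbing (m : R) (k0 : nat) : (forall t, dle t m) ->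
  (forall r : R, r <> 0%R -> dle m (r *+ k0)%R) -> weak_EI M.
Proof.
move=> m_max m_mulrn [x|e]; first exact: weak_EI_home.
have [a ->] := im_projP e; move: (imsort e) a => S a {e}.
set n := eqsize S in a *.
pose E (N : structure (dist_sig R)) (f : 'I_n + 'I_n -> N) :=
  sat (eqform S) (fun x => f (if x.1 then inr x.2 else inl x.2)).
have EE (x y : 'I_n -> M) : E M (sumf x y) <-> @Defs.eqrel _ M S x y.
  rewrite /E /Defs.eqrel /rel_of_form.
  suff -> : (fun u : bool * 'I_n => sumf x y (if u.1 then inr u.2 else inl u.2)) =
    fun u => if u.1 then y u.2 else x u.2 by [].
  by apply/funext => -[[] i].
have dE : definable E by exists (rename (fun x : bool * 'I_n =>
  if x.1 then inr x.2 else inl x.2) (eqform S)) => N f; apply: sat_rename.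
have [refl sym trans] := eqformP S.
pose X x := E M (sumf a x).
have Xa : invariant_over X a.
  by move=> x y xy; apply: (agree_sat dE xy).1.
have /ex_minnP[k] : exists k, `[< exists c : 'I_k -> M, invariant_over X c >].
  by exists n; apply/asboolP; exists a.
move=> /asboolP[c Xc] kmin.
have {}kmin j (d : 'I_j -> M) : invariant_over X d -> (k <= j)%N.
  by move=> Xd; apply: kmin; apply/asboolP; exists d.
have [|l Hl] := invariant_over_isolated dE Xc; first exact/EE/refl.
have cE (f : option 'I_k -> Meq M) : (forall i, f (Some i) = inl (c i)) ->
    class_of_type a c l f <-> f None = inr (im_proj a).
  move=> fc; rewrite (class_of_typeE _ _ _ fc); split=> [[x [-> /Hl/EE ax]]|->].
    by congr (inr _); apply/esym/im_proj_eq.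
  by exists a; split=> // r _.
exists k, c; split; last first.
  have [phi Hphi] := def_class_of_type a c l.
  exists k, (fun i => inl (c i)), phi; split=> [i|]; first by exists i.
  apply/seteqP; split=> y /=; first by move/Hphi/cE; apply.
  by move=> ->; apply/Hphi/cE.
move=> i; have [phi Hphi] := def_entry_of_type a c l i.
exists 1, (fun _ => inr (im_proj a)), phi; split=> //.
  apply/Hphi; exists (fun i => inl (c i)); split=> //.
  - by move=> j; exists (c j).
  - exact/cE.
  - by move=> z /cE; apply.
apply: (@sub_finite_set _ _ (range (fun i => inl (c i) : Meq M))); last first.
  by apply: finite_image; apply: finite_finset.
move=> y /Hphi[w [/= <- whome]].
have /choice[w' Hw] : forall j, exists u, w j = inl u by move=> j; apply: whome.
have wS z : forall i, oapp w z (Some i) = inl (w' i) by [].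
rewrite (class_of_typeE _ _ _ (wS _)) => -[x0 [/= ax0 Hx0]] uniq.
have Xw : invariant_over X w'.
  move=> x y' xy Xx.
  have [g gaut gxy] := agree_automorphism xy.
  have gx : g \o x = y' by apply/funext => j; apply: (gxy (inr j)).
  have E0 : inr (im_proj (g \o x0)) = inr (im_proj a) :> Meq M.
    apply: uniq; apply/(class_of_typeE _ _ _ (wS _)); exists (g \o x0); split=> //.
    have -> : sumf w' (g \o x0) = g \o sumf w' x0.
      by apply/funext => -[j|//]; apply/esym/(gxy (inl j)).
    move=> r rl p q; apply: iff_trans (Hx0 r rl p q) _.
    exact: iff_sym (dleq_automorphism _ _ _ gaut).
  have inr_inj (e f : imaginary M) : inr e = inr f :> Meq M -> e = f by case.
  move: ax0 E0 => /inr_inj/im_proj_inj ax0 /inr_inj/im_proj_inj gx0a.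
  apply/EE/(trans _ (g \o x0)); first exact: sym.
  rewrite -gx; apply/eqrel_automorphism => //.
  by apply: trans (sym _ _ ax0) _; apply/EE.
have [j cj] := invariant_over_min m_max m_mulrn kmin Xw Xc i.
by rewrite Hw -cj; exists j.
Qed.

Lemma archimedean_weak_EI : SO_finite K M -> archimedean R -> weak_EI M.
Proof.
move=> [n SOn] archR.
have absorb (r : R) := mulrn_absorb (SO_le_mulrn SOn r).
have mul_max (r s : R) : r <> 0%R -> dle s (r *+ n.+1)%R.
  move=> r0; have [->|/eqP s0] := eqVneq s 0%R; first exact: dle0r.
  have pos (t : R) : t <> 0%R -> dlt 0%R t.
    by move=> t0; rewrite /dlt dle0r andbT eq_sym; apply/eqP.
  have [k [_ sk]] := archR r s (pos _ r0) (pos _ s0).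
  exact: dle_trans sk (absorb r k).
(* the trivial monoid has [0] for its greatest element *)
have [[r r0]|triv] := pselect (exists r : R, r <> 0%R).
  by apply: (@weak_EI_of_absorbing (r *+ n.+1)%R n.+1) => [t|s s0]; apply: mul_max.
have R0 (t : R) : t = 0%R by apply: contrapT => t0; apply: triv; exists t.
by apply: (@weak_EI_of_absorbing 0%R 0) => [t|s /(_ (R0 s))//]; rewrite (R0 t) dle_refl.
Qed.

End Monster.

Theorem corollary7p11 (R : distMonoid) (U : rmetric R) (K : Type) (M : structure (dist_sig R)) :
  urysohn_monoid R ->
  urysohn_space U ->
  monster (Th (dist_structure U)) K M ->
  SO_finite K M ->
  (weak_EI M <-> archimedean R).
Proof.
move=> urysohnR urysohnU monsterM SOfin; split.
  exact: (weak_EI_archimedean urysohnR urysohnU monsterM SOfin).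
exact: (archimedean_weak_EI urysohnR urysohnU monsterM SOfin).
Qed.
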